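(* Let $S$ and $T$ be two countably infinite, congruence-free Boolean inverse $\wedge$-monoids. Then the following are equivalent: (1) $S$ and $T$ are isomorphic. (2) The groups of units of $S$ and $T$ are isomorphic.
   Context: An inverse semigroup $S$ carries the natural partial order: $s\le t$ iff $s=te$ for some idempotent $e$. $E(S)$ is the semilattice of idempotents of $S$. All inverse monoids here have a zero. Elements $a,b$ are compatible if $ab^{-1}$ and $a^{-1}b$ are both idempotents. An inverse semigroup is distributive if every compatible pair of elements has a join and multiplication distributes over any binary joins that exist. A Boolean inverse monoid is a distributive inverse monoid $S$ such that $E(S)$ is a (unital) Boolean algebra; it is a Boolean inverse $\wedge$-monoid if in addition every pair of elements has a meet $a\wedge b$. An inverse semigroup is congruence-free if it has exactly two congruences. The group of units of $S$ is the group of invertible elements of $S$. *)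

(* Defs.v *)
From HB Require Import structures.
From mathcomp Require Import all_boot all_order.
From mathcomp Require Import all_fingroup.
From mathcomp Require Import boolp classical_sets functions cardinality.

Set Implicit Arguments.
Unset Strict Implicit.
Unset Printing Implicit Defensive.

Local Open Scope classical_set_scope.
Local Open Scope group_scope.

(* The zero is part of the structure: every inverse monoid considered has one.
   Involutivity and antimultiplicativity of the inverse, inherited from
   starMonoidType, follow from the other axioms: see the factory below. *)
HB.mixin Record StarMonoid_isInverseMonoid S of StarMonoid S := {
  mulgVKg : forall x : S, x * x^-1 * x = x;
  inverse_unique : forall x y : S, x * y * x = x -> y * x * y = y -> y = x^-1;
  zerog : S;
  mul0g : left_zero zerog (@mul S);
  mulg0 : right_zero zerog (@mul S)
}.

#[short(type="inverseMonoidType")]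
HB.structure Definition InverseMonoid :=
  { S of StarMonoid_isInverseMonoid S & StarMonoid S }.

HB.factory Record Monoid_isInverseMonoid S of Monoid S := {
  inv : S -> S;
  mulgVKg : forall x : S, x * inv x * x = x;
  mulVgKg : forall x : S, inv x * x * inv x = inv x;
  inverse_unique : forall x y : S, x * y * x = x -> y * x * y = y -> y = inv x;
  zerog : S;
  mul0g : left_zero zerog (@mul S);
  mulg0 : right_zero zerog (@mul S)
}.

HB.builders Context S of Monoid_isInverseMonoid S.

Lemma invgK : involutive inv.
Proof. by move=> x; apply/esym/inverse_unique; [apply: mulVgKg|apply: mulgVKg]. Qed.

Lemma idem_inv (e : S) : e * e = e -> inv e = e.
Proof. by move=> ee; apply/esym/inverse_unique; rewrite !ee. Qed.

Lemma idemM (e f : S) : e * e = e -> f * f = f -> e * f * (e * f) = e * f.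
Proof.
move=> ee ff; set x := inv (e * f).
have K1 : e * f * x * (e * f) = e * f by apply: mulgVKg.
have K2 : x * (e * f) * x = x by apply: mulVgKg.
have xE : f * x * e = x.
  apply: inverse_unique.
    by rewrite -[RHS]K1 !mulgA -(mulgA e f f) ff -(mulgA _ e e) ee.
  rewrite -[in RHS]K2 !mulgA -(mulgA (f * x) e e) ee.
  by rewrite -(mulgA (f * x * e) f f) ff.
have xx : x * x = x.
  by rewrite -{1 2}xE -[RHS]xE -[in RHS]K2 !mulgA.
by rewrite -[e * f]invgK -/x (idem_inv xx).
Qed.

Lemma idemC (e f : S) : e * e = e -> f * f = f -> e * f = f * e.
Proof.
move=> ee ff; have efI := idemM ee ff; have feI := idemM ff ee.
rewrite -[LHS](idem_inv efI); apply/esym/inverse_unique.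
  by rewrite -[RHS]efI !mulgA -(mulgA e f f) ff -(mulgA _ e e) ee.
by rewrite -[RHS]feI !mulgA -(mulgA f e e) ee -(mulgA _ f f) ff.
Qed.

Lemma invgM : {morph inv : x y / x * y >-> y * x}.
Proof.
move=> x y; apply/esym/inverse_unique.
- have -> : x * y * (inv y * inv x) * (x * y)
          = x * ((y * inv y) * (inv x * x)) * y by rewrite !mulgA.
  rewrite (@idemC (y * inv y)) ?mulgA ?mulgVKg ?mulVgKg //.
  by rewrite -(mulgA x) -(mulgA x) mulgVKg.
- have -> : inv y * inv x * (x * y) * (inv y * inv x)
          = inv y * ((inv x * x) * (y * inv y)) * inv x by rewrite !mulgA.
  rewrite (@idemC (inv x * x)) ?mulgA ?mulgVKg ?mulVgKg //.
  by rewrite -(mulgA (inv y)) -(mulgA (inv y)) mulVgKg.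
Qed.

HB.instance Definition _ := hasInv.Build S inv.
HB.instance Definition _ := Monoid_isStarMonoid.Build S invgK invgM.
HB.instance Definition _ :=
  StarMonoid_isInverseMonoid.Build S mulgVKg inverse_unique mul0g mulg0.

HB.end.

Bind Scope group_scope with InverseMonoid.sort.

Section InverseMonoidNotions.
Variable S : inverseMonoidType.
Implicit Types a b c e m j s t x y : S.

Definition idempotent_elt e : Prop := e * e = e.

Definition natural_le s t : Prop := exists2 e, idempotent_elt e & s = t * e.

Definition compatible a b : Prop :=
  idempotent_elt (a * b^-1) /\ idempotent_elt (a^-1 * b).

Definition is_join a b j : Prop :=
  [/\ natural_le a j, natural_le b j &
      forall c, natural_le a c -> natural_le b c -> natural_le j c].

Definition is_meet a b m : Prop :=
  [/\ natural_le m a, natural_le m b &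
      forall c, natural_le c a -> natural_le c b -> natural_le c m].

Definition distributive_inverse : Prop :=
  (forall a b, compatible a b -> exists j, is_join a b j) /\
  (forall a b j x, is_join a b j ->
     is_join (x * a) (x * b) (x * j) /\ is_join (a * x) (b * x) (j * x)).

(* E(S), ordered by the restriction of the natural partial order, is
   order-isomorphic to a bounded complemented distributive lattice. *)
Definition boolean_idempotents : Prop :=
  exists (d : Order.disp_t) (B : ctbDistrLatticeType d) (f : B -> S),
    [/\ injective f, range f = [set e | idempotent_elt e] &
        forall x y : B, (x <= y)%O <-> natural_le (f x) (f y)].

Definition boolean_inverse_monoid : Prop :=
  distributive_inverse /\ boolean_idempotents.

Definition boolean_inverse_meet_monoid : Prop :=
  boolean_inverse_monoid /\ forall a b, exists m, is_meet a b m.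

Definition congruence (R : S -> S -> Prop) : Prop :=
  RelationClasses.Equivalence R /\
  forall a b c d, R a b -> R c d -> R (a * c) (b * d).

Definition congruence_free : Prop :=
  ([set R : S -> S -> Prop | congruence R] #= `I_2)%card.

Definition countably_infinite : Prop := ([set: S] #= [set: nat])%card.

Definition invertible : pred S :=
  fun x => `[< exists y, x * y = 1 /\ y * x = 1 >].

Lemma invertibleP x :
  reflect (exists y, x * y = 1 /\ y * x = 1) (invertible x).
Proof. exact: asboolP. Qed.

Lemma invertible_umagma_closed : umagma_closed (invertible : {pred S}).
Proof.
split; first by apply/invertibleP; exists 1; rewrite mulg1.
move=> x y /invertibleP[x' [xx' x'x]] /invertibleP[y' [yy' y'y]].
apply/invertibleP; exists (y' * x'); split.
  by rewrite -mulgA (mulgA y) yy' mul1g.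
by rewrite -mulgA (mulgA x') x'x mul1g.
Qed.

Lemma invertible_inv x y : x * y = 1 -> y * x = 1 -> x^-1 = y.
Proof. by move=> xy yx; rewrite -(@inverse_unique _ x y) ?xy ?yx ?mul1g. Qed.

Lemma invertible_mulgV x : invertible x -> x * x^-1 = 1.
Proof. by case/invertibleP=> y [xy yx]; rewrite (invertible_inv xy yx). Qed.

Lemma invertible_mulVg x : invertible x -> x^-1 * x = 1.
Proof. by case/invertibleP=> y [xy yx]; rewrite (invertible_inv xy yx). Qed.

Lemma invertibleV x : invertible x -> invertible x^-1.
Proof.
by move=> ux; apply/invertibleP; exists x; rewrite invertible_mulgV ?invertible_mulVg.
Qed.

End InverseMonoidNotions.

Record units (S : inverseMonoidType) :=
  Unit { unit_val :> S; unit_valP : invertible unit_val }.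

Section UnitGroup.
Variable S : inverseMonoidType.

HB.instance Definition _ := [isSub for @unit_val S].
HB.instance Definition _ := [Choice of units S by <:].
HB.instance Definition _ :=
  SubChoice_isSubMonoid.Build S (@invertible S) (units S)
    (invertible_umagma_closed S).

Definition unit_inv (u : units S) : units S := Unit (invertibleV (unit_valP u)).

HB.instance Definition _ := hasInv.Build (units S) unit_inv.

Lemma unit_mulVg : left_inverse 1 (fun u : units S => u^-1) *%g.
Proof.
move=> u; apply: val_inj; rewrite valM val1 /=.
exact: invertible_mulVg (unit_valP u).
Qed.

Lemma unit_mulgV : right_inverse 1 (fun u : units S => u^-1) *%g.
Proof.
move=> u; apply: val_inj; rewrite valM val1 /=.
exact: invertible_mulgV (unit_valP u).
Qed.

HB.instance Definition _ := Monoid_isGroup.Build (units S) unit_mulVg unit_mulgV.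

End UnitGroup.

(* For inverse monoids (resp. groups), a multiplicative bijection preserving 1
   automatically preserves inverses and the zero. *)
Definition isomorphic (G H : monoidType) : Prop :=
  exists f : UMagmaMorphism.type G H, bijective f.

(* Main.v *)
(* The points of the Stone space of E(S) are its prime filters.  Congruence-
   freeness, applied to the congruence attached to an invariant ideal of E(S),
   makes every orbit dense and E(S) atomless; applied to the maximal
   idempotent-separating congruence, it makes S act faithfully.  An element s
   moving a point x to another point agrees near x with an involution in the
   group of units, which exchanges two disjoint clopen sets.  Hence the unit
   group acts on the Stone space in a locally moving way, and the short proof
   of Rubin's theorem by Belk, Elliott and Matucci shows that inclusion between
   closures of supports is definable in the group.  Thanks to meets these
   closures are clopen; they generate E(S), which is therefore recovered
   equivariantly from the group.  Finally every element of S is a finite join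
   of products of idempotents and units: near a fixed point x of s write
   s = (s g^-1) g with g a unit moving x. *)

From HB Require Import structures.
From mathcomp Require Import all_boot all_order all_fingroup.
From mathcomp Require Import boolp classical_sets functions cardinality.
Require Import Defs.

Set Implicit Arguments.
Unset Strict Implicit.
Unset Printing Implicit Defensive.

Import Order.TTheory Order.CTheory.
Local Open Scope classical_set_scope.
Local Open Scope group_scope.

Local Notation "0" := (@zerog _) : group_scope.
Local Notation idem := idempotent_elt.

(** * Inverse monoids and complements of idempotents *)

Section InverseMonoid.
Variable S : inverseMonoidType.
Implicit Types a b c e f g s t : S.

Lemma mulVgKg s : s^-1 * s * s^-1 = s^-1.
Proof. by have := mulgVKg s^-1; rewrite invgK. Qed.

Lemma idem0 : idem (0 : S). Proof. by rewrite /idempotent_elt mul0g. Qed.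

Lemma idem1 : idem (1 : S). Proof. by rewrite /idempotent_elt mul1g. Qed.

Lemma idemV e : idem e -> e^-1 = e.
Proof. by move=> ee; apply/esym/inverse_unique; rewrite !ee. Qed.

Lemma invg0 : (0 : S)^-1 = 0. Proof. exact: idemV idem0. Qed.

Lemma idemM e f : idem e -> idem f -> idem (e * f).
Proof.
move=> ee ff; have := mulgVKg (e * f); rewrite invgM !idemV // => E.
by rewrite /idempotent_elt -[RHS]E !mulgA -(mulgA e f f) ff -(mulgA _ e e) ee.
Qed.

Lemma idemC e f : idem e -> idem f -> e * f = f * e.
Proof.
by move=> ee ff; rewrite -(idemV (idemM ee ff)) invgM !idemV.
Qed.

Lemma idem_mulVg s : idem (s^-1 * s).
Proof. by rewrite /idempotent_elt mulgA mulVgKg. Qed.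

Lemma idem_mulgV s : idem (s * s^-1).
Proof. by rewrite /idempotent_elt mulgA mulgVKg. Qed.

(** [e] commutes with the idempotent [s^-1 * s]. The rule carries an idempotent across [s] as a
    conjugate. *)
Lemma mulg_idem s e : idem e -> s * e = s * e * s^-1 * s.
Proof.
move=> ee; rewrite -!mulgA (idemC ee (idem_mulVg s)) !mulgA.
by rewrite mulgVKg.
Qed.

Lemma idem_conj s e : idem e -> idem (s * e * s^-1).
Proof.
move=> ee; rewrite /idempotent_elt mulgA mulgA -(mulg_idem s ee).
by rewrite -(mulgA s e e) ee.
Qed.

Lemma idem_conjV s e : idem e -> idem (s^-1 * e * s).
Proof. by move/(idem_conj s^-1); rewrite invgK. Qed.

Lemma idem_mulg s e : idem e -> e * s = s * (s^-1 * e * s).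
Proof.
move=> ee; have := congr1 (fun z => z^-1) (mulg_idem s^-1 ee).
by rewrite /= !invgM ?invgK (idemV ee) !mulgA.
Qed.

Lemma conjM s e f : idem e -> idem f ->
  s * (e * f) * s^-1 = s * e * s^-1 * (s * f * s^-1).
Proof. by move=> ee ff; rewrite !mulgA -(mulg_idem s ee). Qed.

Lemma conjMV s e f : idem e -> idem f ->
  s^-1 * (e * f) * s = s^-1 * e * s * (s^-1 * f * s).
Proof. by move=> ee ff; have := conjM s^-1 ee ff; rewrite invgK. Qed.

Lemma natural_leP s t : natural_le s t -> s = t * (s^-1 * s).
Proof.
case=> e ee ->; rewrite invgM idemV // !mulgA -!mulgA (mulgA t^-1).
rewrite (mulgA e) (idemC ee (idem_mulVg t)) -!(mulgA _ e e) ee !mulgA.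
by rewrite mulgVKg.
Qed.

Lemma natural_le_refl s : natural_le s s.
Proof. by exists 1; rewrite ?mulg1 //; exact: idem1. Qed.

Lemma natural_le_anti s t : natural_le s t -> natural_le t s -> s = t.
Proof.
move=> [e ee sE] [f ff tE].
have se : s * e = s by rewrite {1}sE -mulgA ee -sE.
by rewrite sE {1}tE -mulgA (idemC ff ee) mulgA se -tE.
Qed.

Lemma natural_le_idem e f : idem f -> natural_le e f <-> idem e /\ f * e = e.
Proof.
move=> ff; split=> [[g gg ->]|[ee fe]]; last by exists e.
by split; [exact: idemM|rewrite mulgA ff].
Qed.

Lemma is_join_unique a b s t : is_join a b s -> is_join a b t -> s = t.
Proof. by case=> [? ? Ms] [? ? Mt]; apply: natural_le_anti; auto. Qed.

Lemma is_join0 s : is_join 0 0 s -> s = 0.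
Proof.
case=> _ _ /(_ 0 (natural_le_refl 0) (natural_le_refl 0)) [e _ ->].
by rewrite mul0g.
Qed.

Lemma is_join_sym a b s : is_join a b s -> is_join b a s.
Proof. by case=> ? ? Ms; split=> // c ? ?; apply: Ms. Qed.

Lemma is_joinx0 a : is_join a 0 a.
Proof.
split=> //; first exact: natural_le_refl.
by exists 0; rewrite ?mulg0 //; exact: idem0.
Qed.

Lemma compatible_idem e f : idem e -> idem f -> compatible e f.
Proof. by move=> ee ff; rewrite /compatible !idemV //; split; exact: idemM. Qed.

Lemma mulg_conj_eq0 s e f : idem e ->
  f * s * e = 0 <-> f * (s * e * s^-1) = 0.
Proof.
move=> ee; split=> E; first by rewrite !mulgA E mul0g.
by rewrite -mulgA (mulg_idem s ee) mulgA E mul0g.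
Qed.

End InverseMonoid.

(* Junk value 0 when e has no complement. *)
Definition neg (S : inverseMonoidType) (e : S) : S :=
  xget 0 [set c | [/\ idem c, e * c = 0 & is_join e c 1]].

Section Boolean.
Variable S : inverseMonoidType.
Hypothesis boolS : boolean_inverse_monoid S.
Implicit Types a b c e f g s t : S.

(** The complement is transported from the lattice [B]. Its join with [e] exists in [S] by
    distributivity, and is 1 because its preimage in [B] lies above an element and the complement of
    that element. *)
Lemma negP e : idem e -> [/\ idem (neg e), e * neg e = 0 & is_join e (neg e) 1].
Proof.
move=> ee; rewrite /neg; case: xgetP => [c -> //|]; case: boolS => [[Dj Dd]].
case=> d [B [F [Finj Frange Fle]]] none; exfalso.
have Fidem x : idem (F x).
  by have : [set e : S | idem e] (F x) by rewrite -Frange; exists x.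
have Fsurj c : idem c -> exists x, F x = c.
  by move=> cc; have : range F c by [rewrite Frange]; case=> x _ <-; exists x.
have [x Fx] := Fsurj e ee; have [w Fw] := Fsurj _ (idem0 S).
have [v Fv] := Fsurj _ (idem1 S).
have F0 : F Order.bottom = 0.
  have /Fle [g _ ->] : (Order.bottom <= w)%O by exact: le0x.
  by rewrite Fw mul0g.
pose c := F (Order.compl x).
have ec0 : e * c = 0.
  have [z Fz] := Fsurj (e * c) (idemM ee (Fidem _)).
  have zx : (z <= x)%O by apply/Fle; rewrite Fz Fx; exists c => //; exact: Fidem.
  have zc : (z <= Order.compl x)%O.
    apply/Fle; rewrite Fz -/c; exists e => //; apply: idemC => //; exact: Fidem.
  suff zE : z = Order.bottom by rewrite -Fz zE F0.
  apply/eqP; rewrite -lex0 -(meetxC x) lexI.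
  by rewrite zx zc.
have [j jE] := Dj e c (compatible_idem ee (Fidem _)).
apply: (none c); split=> //; first exact: Fidem.
suff j1 : j = 1 by rewrite -j1.
have [ej cj Mj] := jE.
have le1 a : idem a -> natural_le a 1 by exists a; rewrite ?mul1g.
have j_le1 := Mj 1 (le1 _ ee) (le1 _ (Fidem _)).
have jj : idem j by case: j_le1 => i ii ->; rewrite mul1g.
have [y Fy] := Fsurj j jj.
apply: natural_le_anti => //.
rewrite -Fy -Fv; apply/Fle; apply: (le_trans (lex1 _)).
by rewrite -(joinxC x) leUx; apply/andP; split; apply/Fle; rewrite Fy ?Fx.
Qed.

Lemma idem_neg e : idem e -> idem (neg e).
Proof. by case/negP. Qed.

Lemma mulg_neg e : idem e -> e * neg e = 0.
Proof. by case/negP. Qed.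

Lemma neg_mulg e : idem e -> neg e * e = 0.
Proof. by move=> ee; rewrite (idemC (idem_neg ee) ee) mulg_neg. Qed.

Lemma is_join_neg e s : idem e -> is_join (s * e) (s * neg e) s.
Proof.
case/negP=> _ _ J; have [J' _] := boolS.1.2 _ _ _ s J; by rewrite mulg1 in J'.
Qed.

(** Distributivity makes every element the join of its restrictions to [e] and [neg e]. *)
Lemma idem_split e s t : idem e -> s * e = t * e -> s * neg e = t * neg e -> s = t.
Proof.
move=> ee E1 E2; have := is_join_neg s ee; rewrite E1 E2 => J.
exact: is_join_unique J (is_join_neg t ee).
Qed.

Lemma mulg_negP s f : idem f -> s * neg f = s <-> s * f = 0.
Proof.
move=> ff; split=> [<-|sf]; first by rewrite -mulgA neg_mulg // mulg0.
apply: (idem_split ff); first by rewrite -mulgA neg_mulg // mulg0.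
by rewrite -mulgA (idem_neg ff).
Qed.

Lemma negK e : idem e -> neg (neg e) = e.
Proof.
move=> ee; have nn := idem_neg ee; apply: (idem_split ee).
  rewrite ee (idemC (idem_neg nn) ee); apply/mulg_negP => //; exact: mulg_neg.
by rewrite neg_mulg // mulg_neg.
Qed.

Lemma mulg_neg_eq0 s f : idem f -> s * neg f = 0 <-> s * f = s.
Proof.
move=> ff; rewrite -[X in _ <-> s * X = s](negK ff).
by rewrite (mulg_negP _ (idem_neg ff)).
Qed.

Lemma neg_mulgP s f : idem f -> neg f * s = s <-> f * s = 0.
Proof.
move=> ff; have nf := idem_neg ff; split=> [<-|fs].
  by rewrite mulgA mulg_neg // mul0g.
have : s^-1 * f = 0 by rewrite -[f in LHS](idemV ff) -invgM fs invg0.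
move/(mulg_negP _ ff)/(congr1 (fun z => z^-1)).
by rewrite /= invgM !invgK (idemV nf).
Qed.

Lemma neg_mulg_eq0 s f : idem f -> neg f * s = 0 <-> f * s = s.
Proof.
by move=> ff; rewrite -[X in _ <-> X * s = s](negK ff) (neg_mulgP _ (idem_neg ff)).
Qed.

(** An idempotent is determined by its annihilator: test with [neg e] and [neg f]. *)
Lemma idem_ext e f : idem e -> idem f ->
  (forall c, idem c -> c * e = 0 <-> c * f = 0) -> e = f.
Proof.
move=> ee ff ext.
have ef : neg e * f = 0 by apply/ext; [exact: idem_neg|exact: neg_mulg].
have fe : neg f * e = 0 by apply/ext; [exact: idem_neg|exact: neg_mulg].
have /mulg_neg_eq0 <- // : e * neg f = 0 by rewrite -(idemC (idem_neg ff)).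
by rewrite idemC //; apply/mulg_neg_eq0 => //; rewrite -(idemC (idem_neg ee)).
Qed.

End Boolean.

(** * Ideals of idempotents and points of the Stone space *)

(* The last clause is closure under joins, stated without joins: g is the join
   of [g * e] and [g * neg e]. *)
Definition ideal (S : inverseMonoidType) (J : set S) : Prop :=
  [/\ J 0, forall e, J e -> idem e, forall e f, J e -> idem f -> J (e * f) &
      forall g e, idem g -> idem e -> J (g * e) -> J (g * neg e) -> J g].

Record stone_point (S : inverseMonoidType) := StonePoint {
  filter_of :> S -> Prop;
  point_idem : forall e, filter_of e -> idem e;
  pointM : forall e f, idem e -> idem f ->
    filter_of (e * f) <-> filter_of e /\ filter_of f;
  point0 : ~ filter_of 0;
  point_neg : forall e, idem e -> filter_of e \/ filter_of (neg e)
}.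

Lemma point_ext (S : inverseMonoidType) (x y : stone_point S) :
  (x : S -> Prop) = y -> x = y.
Proof.
case: x y => [x x1 x2 x3 x4] [y y1 y2 y3 y4] /= E; subst y.
by congr StonePoint; exact: Prop_irrelevance.
Qed.

Section Ideals.
Variable S : inverseMonoidType.
Hypothesis boolS : boolean_inverse_monoid S.
Implicit Types (a b c e f g s t : S) (J : set S) (x y : stone_point S).

(** This is the ideal generated by [J] and [neg e]; it serves to exploit maximality in
    [prime_ideal]. *)
Lemma ideal_ext J e : ideal J -> idem e -> ideal [set g | idem g /\ J (g * e)].
Proof.
case=> J0 Jidem Jdown Jsplit ee; split=> /=.
- by split; [exact: idem0|rewrite mul0g].
- by move=> g [].
- move=> g f [gg Jg] ff; split; first exact: idemM.
  by rewrite -mulgA (idemC ff ee) mulgA; exact: Jdown.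
- move=> g f gg ff [_ J1] [_ J2]; split=> //.
  apply: (Jsplit _ f) => //; first exact: idemM.
    by rewrite -mulgA (idemC ee ff) mulgA.
  by rewrite -mulgA (idemC ee (idem_neg boolS ff)) mulgA.
Qed.

(** Split [neg (e * f)] along [e]: the parts lie below [neg f] and [neg e]. *)
Lemma ideal_neg_mul J e f : ideal J -> idem e -> idem f ->
  J (neg e) -> J (neg f) -> J (neg (e * f)).
Proof.
case=> J0 Jidem Jdown Jsplit ee ff Je Jf.
have ef := idemM ee ff; have nef := idem_neg boolS ef.
have nf := idem_neg boolS ff; have ne := idem_neg boolS ee.
apply: (Jsplit _ e) => //; last first.
  by rewrite (idemC nef ne); exact: Jdown.
have <- : neg f * (neg (e * f) * e) = neg (e * f) * e; last first.
  by apply: Jdown => //; exact: idemM.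
rewrite (idemC nf (idemM nef ee)).
by apply/(mulg_negP boolS) => //; rewrite -mulgA neg_mulg.
Qed.

(** The complement of a maximal proper ideal containing [J] is a point. *)
Lemma prime_ideal J : ideal J -> ~ J 1 -> exists x, forall e, J e -> ~ x e.
Proof.
(* Zorn ranges over sets whose union with [J] is a proper ideal, so that the empty chain, with empty
   union, is admissible. *)
move=> idJ J1; pose P (A : set S) := ideal (A `|` J) /\ ~ (A `|` J) 1.
have [|A [[idA A1] Amax]] := @Zorn_bigcup S P.
  move=> F FP Ftot; split; last first.
    by case=> // -[A FA A1]; have [_] := FP _ FA; apply; left.
  have [->|/set0P[A0 FA0]] := eqVneq F set0.
  - by rewrite bigcup_set0 set0U.
  - have sub A : F A -> A `|` J `<=` \bigcup_(X in F) X `|` J.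
      by move=> FA s [As|Js]; [left; exists A|right].
    have lift s : (\bigcup_(X in F) X `|` J) s -> exists2 A, F A & (A `|` J) s.
      by case=> [[A FA As]|Js]; [exists A => //; left|exists A0 => //; right].
    split.
    + by right; case: idJ.
    + by move=> e /lift[A FA Ae]; have [[_ H _ _] _] := FP _ FA; exact: H Ae.
    + move=> e f /lift[A FA Ae] ff; apply: (sub A FA).
      by have [[_ _ H _] _] := FP _ FA; exact: H.
    + move=> g e gg ee /lift[A FA Ae] /lift[B FB Be].
      have [AB|BA] := Ftot _ _ FA FB.
        apply: (sub B FB); have [[_ _ _ /(_ g e) H] _] := FP _ FB; apply: H => //.
        by case: Ae => [/AB|]; [left|right].
      apply: (sub A FA); have [[_ _ _ /(_ g e) H] _] := FP _ FA; apply: H => //.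
      by case: Be => [/BA|]; [left|right].
set I := A `|` J in idA A1.
have prime e : idem e -> I e \/ I (neg e).
  move=> ee; have [|nIe] := pselect (I e); first by left.
  (* Otherwise enlarging [I] by [neg e] contradicts maximality: the result contains 1 only if [e] is
     in [I]. *)
  right; apply: contrapT => nIne; case: (Amax [set g | idem g /\ I (g * e)]).
  - split=> [s As|/(_ (neg e)) sub].
      by case: idA => _ Iidem Idown _; split; [apply: Iidem; left|apply: Idown => //; left].
    apply: nIne; left; apply: sub; split; first exact: idem_neg.
    by rewrite neg_mulg //; case: idA.
  - suff IE : [set g | idem g /\ I (g * e)] `|` J = [set g | idem g /\ I (g * e)].
      by rewrite /P IE; split; [exact: ideal_ext|case=> _; rewrite mul1g].
    apply/setUidPl => s Js; case: idA => _ Iidem Idown _.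
    by split; [apply: Iidem; right|apply: Idown => //; right].
have xM e f : idem e -> idem f ->
    (idem (e * f) /\ ~ I (e * f)) <-> (idem e /\ ~ I e) /\ (idem f /\ ~ I f).
  case: idA => I0 Iidem Idown Isplit ee ff; split.
    case=> _ nI; split; split=> //; apply: contra_not nI => nI; first exact: Idown.
    by rewrite idemC //; exact: Idown.
  case=> -[_ nIe] [_ nIf]; split; first exact: idemM.
  apply: contra_not nIf => Ief; have [//|Ine] := prime e ee.
  apply: (Isplit _ e) => //; first by rewrite idemC.
  by rewrite idemC //; [exact: Idown|exact: idem_neg].
have x0 : ~ (idem (0 : S) /\ ~ I 0) by case: idA => I0 _ _ _ [].
have xneg e : idem e -> (idem e /\ ~ I e) \/ (idem (neg e) /\ ~ I (neg e)).
  move=> ee; have [Ie|] := pselect (I e); last by left.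
  right; split; first exact: idem_neg.
  apply: contra_not A1 => Ine; case: idA => I0 Iidem Idown Isplit.
  by apply: (Isplit _ e); rewrite ?mul1g //; exact: idem1.
exists (@StonePoint _ (fun e => idem e /\ ~ I e) (fun e => @proj1 _ _) xM x0 xneg).
by move=> e Je [_]; apply; right.
Qed.

Lemma point_up x e f : x e -> idem f -> e * f = e -> x f.
Proof.
move=> xe ff ef; have := xe; rewrite -{1}ef.
by case/pointM => //; exact: point_idem xe.
Qed.

Lemma point1 x : x 1.
Proof.
case: (point_neg x (idem1 S)) => // x1; apply: (point_up x1 (idem1 S)).
by rewrite mulg1.
Qed.

Lemma point_negP x e : idem e -> x (neg e) <-> ~ x e.
Proof.
move=> ee; split=> [xne xe|nxe]; last by case: (point_neg x ee).
have := proj2 (pointM x ee (idem_neg boolS ee)) (conj xe xne).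
by rewrite mulg_neg //; exact: point0.
Qed.

Lemma point_join x e f g : idem e -> idem f -> idem g -> is_join e f g ->
  x g -> x e \/ x f.
Proof.
move=> ee ff gg efg xg; have [ne nf] := (idem_neg boolS ee, idem_neg boolS ff).
have [xe|/(point_negP x ee) xne] := pselect (x e); first by left.
have [xf|/(point_negP x ff) xnf] := pselect (x f); first by right.
have := boolS.1.2 _ _ _ (neg e * neg f) efg => -[_].
rewrite mulgA mulg_neg // mul0g (idemC ne nf) mulgA mulg_neg // mul0g => /is_join0 E.
case: (@point0 _ x); rewrite -E; apply/pointM => //; first exact: idemM.
by split=> //; apply/pointM.
Qed.

(** Apply [prime_ideal] to the annihilator of [e], which is proper and contains [neg e]. *)
Lemma point_mem e : idem e -> e <> 0 -> exists x, x e.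
Proof.
move=> ee e0; have [||x xP] := @prime_ideal [set g | idem g /\ g * e = 0].
- split=> /= [|g []//|g f [gg ge] ff|g f gg ff [_ g1] [_ g2]].
  + by split; [exact: idem0|rewrite mul0g].
  + by split; [exact: idemM|rewrite -mulgA (idemC ff ee) mulgA ge mul0g].
  + split=> //; apply: (idem_split boolS ff); rewrite mul0g.
      by rewrite -mulgA (idemC ee ff) mulgA.
    by rewrite -mulgA (idemC ee (idem_neg boolS ff)) mulgA.
- by case=> _; rewrite mul1g.
exists x; case: (point_neg x ee) => // xne; case: (xP (neg e)) => //.
by split; [exact: idem_neg|exact: neg_mulg].
Qed.

Lemma idem_le_points e f : idem e -> idem f -> (forall x, x e -> x f) -> e * f = e.
Proof.
move=> ee ff sub; apply/(mulg_neg_eq0 boolS) => //; apply: contrapT => N.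
have nf := idem_neg boolS ff.
have [x /pointM[] // /sub xf /(point_negP _ ff)] := point_mem (idemM ee nf) N.
by [].
Qed.

Lemma idem_eq_points e f : idem e -> idem f -> (forall x, x e <-> x f) -> e = f.
Proof.
move=> ee ff E; rewrite -(idem_le_points ee ff (fun x => proj1 (E x))).
by rewrite idemC //; apply: idem_le_points => // x /E.
Qed.

End Ideals.

(** * Consequences of congruence-freeness *)

Definition simple_tarski (S : inverseMonoidType) : Prop :=
  [/\ countably_infinite S, congruence_free S & boolean_inverse_meet_monoid S].

Section Simple.
Variable S : inverseMonoidType.
Hypothesis tarskiS : simple_tarski S.
Implicit Types (a b c e f g s t : S) (J : set S) (x y : stone_point S).

Local Open Scope card_scope.

Let boolS : boolean_inverse_monoid S. Proof. by case: tarskiS => _ _ []. Qed.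

Lemma infinite_tarski : infinite_set [set: S].
Proof.
case: tarskiS => + _ _ => SN; have /eq_finite_set -> : [set: S] #= [set: nat] := SN.
exact: infinite_nat.
Qed.

Lemma one_neq0 : (1 : S) <> 0.
Proof.
move=> E; apply: infinite_tarski.
rewrite (_ : [set: S] = [set 0]); first exact: finite_set1.
by apply/seteqP; split=> // s _ /=; rewrite -[s]mulg1 E mulg0.
Qed.

(** Equality and the total relation are distinct congruences because 1 differs from 0, so they are
    the only two. *)
Lemma congruence_dichotomy (R : S -> S -> Prop) : congruence R ->
  (forall a b, R a b -> a = b) \/ (forall a b, R a b).
Proof.
move=> cR; case: tarskiS => _ + _ => /card_eqPle[/pcard_leP[h] _].
have ceq : congruence (@eq S) by split=> [|? ? ? ? -> ->//]; split=> // ? ? ? -> ->.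
have cT : congruence (fun _ _ : S => True) by split.
have h2 Q : congruence Q -> (h Q < 2)%N by move=> cQ; exact: (@funS _ _ _ _ h).
have hinj Q Q' : congruence Q -> congruence Q' -> h Q = h Q' -> Q = Q'.
  by move=> cQ cQ'; apply: (@inj _ _ _ h); exact/mem_set.
have neq : h (@eq S) <> h (fun _ _ : S => True).
  move=> /(hinj _ _ ceq cT) E; apply: one_neq0.
  by have -> : (1 = 0 :> S) = True by exact: (congr1 (fun Q => Q 1 0) E).
have [E|E] : h R = h (@eq S) \/ h R = h (fun _ _ : S => True).
- move: (h2 _ ceq) (h2 _ cT) (h2 _ cR) neq.
  case: (h _) => [|[|//]]; case: (h _) => [|[|//]]; case: (h _) => [|[|//]] //;
  by auto.
- by left=> a b; rewrite (hinj _ _ cR ceq E).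
- by right=> a b; rewrite (hinj _ _ cR cT E).
Qed.

(** Acting alike on idempotents by conjugation is a congruence that separates 1 from 0. *)
Lemma fundamental a b :
  (forall e, idem e -> a * e * a^-1 = b * e * b^-1) -> a = b.
Proof.
move=> ab; pose R s t := forall e, idem e -> s * e * s^-1 = t * e * t^-1.
have cR : congruence R.
  split; first split=> //.
  - by move=> s t st e ee; rewrite st.
  - by move=> s t u st tu e ee; rewrite st ?tu.
  move=> s t u v st uv e ee.
  have mulE p q : p * q * e * (p * q)^-1 = p * (q * e * q^-1) * p^-1.
    by rewrite invgM !mulgA.
  by rewrite !mulE uv // st //; exact: idem_conj.
have [Req|RT] := congruence_dichotomy cR; first exact: Req.
case: one_neq0; have := RT 1 0 1 (idem1 S).
by rewrite invg1 !mulg1 !mul0g.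
Qed.

(* The congruence attached to J identifies a and b when they agree on an
   idempotent whose complement lies in J. *)
Lemma invariant_ideal J e : ideal J ->
  (forall s f, J f -> J (s * f * s^-1)) -> J e -> e <> 0 -> J 1.
Proof.
move=> idJ Jinv Je e0; have [J0 Jidem Jdown Jsplit] := idJ.
have negJ f : idem f -> J f -> J (neg (neg f)) by move=> ff; rewrite (negK boolS).
pose R a b := exists f, [/\ idem f, J (neg f) & a * f = b * f].
have cR : congruence R.
  split; first split.
  - move=> a; exists 1; split=> //; first exact: idem1.
    by have := mulg_neg boolS (idem1 S); rewrite mul1g => ->.
  - by move=> a b [f [? ? E]]; exists f.
  - move=> a b c [f [ff Jf E]] [g [gg Jg E']]; exists (f * g).
    split; [exact: idemM|exact: ideal_neg_mul|].
    by rewrite mulgA E -mulgA (idemC ff gg) mulgA E' mulgA.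
  move=> a b c d [f [ff Jf E]] [g [gg Jg E']].
  have nf := idem_neg boolS ff; have kk := idem_conjV c nf.
  (* As [a] and [b] agree on [f] only, [c] must land in [f]: remove from its domain the preimage of
     [neg f], which is in [J] by invariance. *)
  exists (g * neg (c^-1 * neg f * c)); split.
  - by apply: idemM => //; exact: idem_neg.
  - apply: (ideal_neg_mul boolS) => //; first exact: idem_neg.
    by apply: negJ => //; have := Jinv c^-1 _ Jf; rewrite invgK.
  set u := neg (c^-1 * neg f * c); have uu : idem u by exact: idem_neg.
  have cuE : f * (c * u) = c * u.
    apply/(neg_mulg_eq0 boolS) => //.
    by rewrite mulgA (idem_mulg c nf) -mulgA mulg_neg // mulg0.
  have acE p : p * c * (g * u) = p * f * (c * u) * g.
    by rewrite (idemC gg uu) -(mulgA p f) cuE !mulgA.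
  by rewrite acE E -acE -!mulgA (mulgA c) E' !mulgA.
have [Req|RT] := congruence_dichotomy cR.
  case: e0; apply: Req; exists (neg e); split.
  - by apply: idem_neg => //; exact: Jidem.
  - by apply: negJ => //; exact: Jidem.
  - by rewrite mul0g mulg_neg //; exact: Jidem.
have [f [ff Jf]] := RT 1 0; rewrite mul1g mul0g => f0.
apply: (Jsplit _ f); rewrite ?mul1g //; first exact: idem1.
by rewrite f0.
Qed.

(* The idempotents none of whose conjugates lie in x form an invariant ideal. *)
Lemma point_meets_orbit x f : idem f -> f <> 0 -> exists a, x (a * f * a^-1).
Proof.
move=> ff f0; apply: contrapT => /forallNP N.
suff : ~ x 1 by case; exact: point1.
pose J := [set e | idem e /\ forall a, ~ x (a * e * a^-1)].
suff [_ /(_ 1)] : J 1 by rewrite invg1 !mulg1.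
have xa0 a : ~ x (a * 0 * a^-1) by rewrite mulg0 mul0g; exact: point0.
apply: (@invariant_ideal J f) => //; last first.
  move=> s e [ee Je]; split; first exact: idem_conj.
  by move=> a; have := Je (a * s); rewrite invgM !mulgA.
split=> [|e []//|e g [ee Je] gg|g e gg ee [_ J1] [_ J2]].
- by split; first exact: idem0.
- split=> [|a]; first exact: idemM.
  rewrite conjM // => /pointM[]; [exact: idem_conj|exact: idem_conj|].
  by move=> /Je.
- split=> // a; have nee := idem_neg boolS ee.
  have J' := is_join_neg boolS g ee.
  have {}J' := (boolS.1.2 _ _ _ a^-1 (boolS.1.2 _ _ _ a J').1).2.
  have ge := idemM gg ee; have gne := idemM gg nee.
  have := point_join boolS (idem_conj a ge) (idem_conj a gne) (idem_conj a gg) J'.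
  by move=> H /H[/J1|/J2].
Qed.

(** By [fundamental], an element is determined by a self-map of the idempotents; a finite set has
    finitely many self-maps. *)
Lemma infinite_idem : infinite_set [set e : S | idem e].
Proof.
move=> /finite_seqP[r rE]; apply: infinite_tarski.
have rP e : idem e -> e \in r.
  by move=> ee; have : [set` r] e by rewrite -rE.
have conjP s (e : seq_sub r) : s * val e * s^-1 \in r.
  apply/rP/idem_conj; have : [set` r] (val e) by exact: (valP e).
  by rewrite -rE.
pose act s : {ffun seq_sub r -> seq_sub r} := [ffun e => SeqSub (conjP s e)].
have act_inj s t : act s = act t -> s = t.
  move=> E; apply: fundamental => e /rP er.
  have : val (act s (SeqSub er)) = val (act t (SeqSub er)) by rewrite E.
  by rewrite /= !ffunE.
pose g h := xget (0 : S) [set s | act s = h].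
rewrite (_ : [set: S] = g @` setT); first exact/finite_image/finite_finset.
apply/seteqP; split=> // s _; exists (act s) => //.
by rewrite /g; case: xgetP => [t _ /act_inj //|/(_ s)]; case.
Qed.

(* If u were an atom, the idempotents with finitely many idempotents below them
   would form a nonzero invariant ideal, so E(S), hence S, would be finite. *)
Lemma atomless u : idem u -> u <> 0 ->
  exists v : S, [/\ idem v, u * v <> 0 & u * neg v <> 0].
Proof.
move=> uu u0; apply: contrapT => /forallNP N.
pose F e := [set f : S | idem f /\ f * e = f]; apply: infinite_idem.
have -> : [set e : S | idem e] = F 1.
  by apply/seteqP; split=> e /=; rewrite /F /= mulg1 => // -[].
suff [//] : [set e | idem e /\ finite_set (F e)] 1.
apply: (@invariant_ideal _ u) => //.
- split=> [|e []//|e f [ee fin] ff|g e gg ee [_ fin1] [_ fin2]].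
  + split; first exact: idem0.
    by apply: sub_finite_set (finite_set1 0) => f [_]; rewrite mulg0 => <-.
  + split; first exact: idemM.
    apply: sub_finite_set fin => h [hh hef]; split=> //.
    by rewrite -{1}hef -!mulgA (idemC ff ee) (mulgA e e) ee hef.
  + split=> //; have nee := idem_neg boolS ee.
    (* An idempotent below [g] is recovered from its parts in [e] and [neg e]. *)
    pose h p := xget (0 : S) [set f | f * e = p.1 /\ f * neg e = p.2].
    apply: sub_finite_set (finite_image h (finite_setX fin1 fin2)) => f [ff fg].
    have memF k : idem k -> F (g * k) (f * k).
      move=> kk; split; first exact: idemM.
      by rewrite -mulgA (mulgA k) (idemC kk gg) -(mulgA g) kk mulgA fg.
    exists (f * e, f * neg e); first by split; exact: memF.
    rewrite /h; case: xgetP => [t -> [/= t1 t2]|/(_ f)]; last by case.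
    exact: (idem_split boolS ee).
- move=> s e [ee fin]; split; first exact: idem_conj.
  apply: sub_finite_set (finite_image (fun f => s * f * s^-1) fin) => f [ff fE].
  have fss : f * (s * s^-1) = f.
    by rewrite -{1}fE -(mulgA f) -(mulgA (s * e)) (mulgA s^-1) mulVgKg fE.
  exists (s^-1 * f * s).
    split; first exact: idem_conjV.
    rewrite -mulgA (mulg_idem s ee).
    have -> : s^-1 * f * (s * e * s^-1 * s) = s^-1 * (f * (s * e * s^-1)) * s.
      by rewrite !mulgA.
    by rewrite fE.
  transitivity (s * s^-1 * (f * (s * s^-1))); first by rewrite !mulgA.
  by rewrite fss idemC //; exact: idem_mulgV.
- split=> //; apply: (@sub_finite_set _ _ [set 0; u]) => // f [ff fu].
  have [uf|nuf] := pselect (u * f = 0).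
    by left; rewrite /= -fu idemC.
  right; have [unf|nunf] := pselect (u * neg f = 0); last by case: (N f).
  by rewrite /= -fu idemC //; apply/(mulg_neg_eq0 boolS).
Qed.

End Simple.

(** * Units exchanging two disjoint idempotents; the action on points *)

Section Swap.
Variable S : inverseMonoidType.
Hypothesis boolS : boolean_inverse_monoid S.
Implicit Types (a b e f g j s t x : S).

Lemma is_join_mulr0 a b j x : is_join a b j -> b * x = 0 -> j * x = a * x.
Proof.
move=> J bx; have [_] := boolS.1.2 _ _ _ x J; rewrite bx => J'.
exact: is_join_unique J' (is_joinx0 _).
Qed.

Lemma is_join_mull0 a b j x : is_join a b j -> x * b = 0 -> x * j = x * a.
Proof.
move=> J xb; have [J' _] := boolS.1.2 _ _ _ x J; rewrite xb in J'.
exact: is_join_unique J' (is_joinx0 _).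
Qed.

(* g is the join of a, a^-1 and the complement of a^-1 a and a a^-1. *)
Lemma swap_unit a : a^-1 * a * (a * a^-1) = 0 ->
  exists g, [/\ g * g = 1, g * (a^-1 * a) = a &
    forall e, idem e -> a * e = a -> e * a = a -> g * neg e = neg e].
Proof.
set e0 := a^-1 * a; set f0 := a * a^-1 => ef0.
have ee : idem e0 := idem_mulVg a; have ff : idem f0 := idem_mulgV a.
have e0E : e0 = a^-1 * a by []; have f0E : f0 = a * a^-1 by [].
clearbody e0 f0.
have ne := idem_neg boolS ee; have nf := idem_neg boolS ff.
have fe0 : f0 * e0 = 0 by rewrite idemC.
have ae : a * e0 = a by rewrite e0E mulgA mulgVKg.
have fa : f0 * a = a by rewrite f0E mulgVKg.
have Vf : a^-1 * f0 = a^-1 by rewrite f0E mulgA mulVgKg.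
have eV : e0 * a^-1 = a^-1 by rewrite e0E mulVgKg.
have aa : a * a = 0.
  transitivity (a * (e0 * f0) * a); first by rewrite -!mulgA fa mulgA ae.
  by rewrite ef0 mulg0 mul0g.
have VV : a^-1 * a^-1 = 0 by rewrite -invgM aa invg0.
pose z := neg e0 * neg f0; have zz : idem z by exact: idemM.
have e0z : e0 * z = 0 by rewrite /z mulgA mulg_neg // mul0g.
have f0z : f0 * z = 0 by rewrite /z (idemC ne nf) mulgA mulg_neg // mul0g.
have az : a * z = 0 by rewrite -ae -mulgA e0z mulg0.
have Vz : a^-1 * z = 0 by rewrite -Vf -mulgA f0z mulg0.
have za : z * a = 0 by rewrite -fa mulgA (idemC zz ff) f0z mul0g.
have zV : z * a^-1 = 0 by rewrite -eV mulgA (idemC zz ee) e0z mul0g.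
(* The vanishing of both squares makes [a] and [a^-1] compatible. *)
have [j J] : exists j, is_join a a^-1 j.
  by apply: boolS.1.1; rewrite /compatible invgK aa VV; split; exact: idem0.
have jz : j * z = 0 by rewrite (is_join_mulr0 J Vz).
have zj : z * j = 0 by rewrite (is_join_mull0 J zV).
have [g G] : exists g, is_join j z g.
  apply: boolS.1.1; rewrite /compatible (idemV zz) jz.
  by rewrite -[j^-1 * z]invgK invgM invgK (idemV zz) zj invg0; split; exact: idem0.
have ga : g * a = e0.
  by rewrite (is_join_mulr0 G za) (is_join_mulr0 (is_join_sym J) aa).
have gV : g * a^-1 = f0.
  by rewrite (is_join_mulr0 G zV) (is_join_mulr0 J VV).
have gz : g * z = z by rewrite (is_join_mulr0 (is_join_sym G) jz).
have ge : g * e0 = a by rewrite e0E mulgA gV fa.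
have gf : g * f0 = a^-1 by rewrite f0E mulgA ga eV.
exists g; split=> //.
  (* Check [g * g = 1] on the partition into [e0], [f0] and the rest [z]. *)
  apply: (idem_split boolS ee); first by rewrite -mulgA ge ga mul1g.
  apply: (idem_split boolS ff).
    by rewrite -!mulgA (idemC ne ff) !mulgA -(mulgA g) gf gV mul1g.
  by rewrite -!mulgA gz gz mul1g.
move=> e eE aeE eaE; have nE := idem_neg boolS eE.
have aN : a * neg e = 0 by apply/(mulg_neg_eq0 boolS).
have Na : neg e * a = 0 by apply/(neg_mulg_eq0 boolS).
have VN : a^-1 * neg e = 0.
  by rewrite -[LHS]invgK invgM invgK (idemV nE) Na invg0.
have jN : j * neg e = 0 by rewrite (is_join_mulr0 J VN).
rewrite (is_join_mulr0 (is_join_sym G) jN) /z -mulgA.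
have -> : neg f0 * neg e = neg e.
  by apply/(neg_mulgP boolS) => //; rewrite f0E -mulgA VN mulg0.
by apply/(neg_mulgP boolS) => //; rewrite e0E -mulgA aN mulg0.
Qed.
End Swap.

Section Action.
Variable S : inverseMonoidType.
Hypothesis boolS : boolean_inverse_monoid S.
Implicit Types (a b e f s t : S) (x y : stone_point S).

(** The dichotomy between [e] and [neg e] holds because [s^-1 * s], which is in [x], is the join of
    their preimages under [s]. *)
Lemma moved_point s x : x (s^-1 * s) ->
  exists y, forall e, y e <-> idem e /\ x (s^-1 * e * s).
Proof.
move=> xs; pose F e := idem e /\ x (s^-1 * e * s).
have FM e f : idem e -> idem f -> F (e * f) <-> F e /\ F f.
  move=> ee ff; rewrite /F conjMV //.
  have := pointM x (idem_conjV s ee) (idem_conjV s ff) => ->.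
  by split=> [[_ []]//|[[_ ?] [_ ?]]]; split=> //; exact: idemM.
have F0 : ~ F 0 by rewrite /F mulg0 mul0g => -[_]; exact: point0.
have Fneg e : idem e -> F e \/ F (neg e).
  move=> ee; have nn := idem_neg boolS ee.
  have := is_join_neg boolS s^-1 ee => J; have [_] := boolS.1.2 _ _ _ s J.
  move/(point_join boolS (idem_conjV s ee) (idem_conjV s nn) (idem_mulVg s)).
  by case/(_ x xs) => ?; [left|right].
by exists (@StonePoint _ F (fun e => @proj1 _ _) FM F0 Fneg).
Qed.

(* Junk value x when x is outside the domain of s. *)
Definition act s x : stone_point S :=
  if pselect (x (s^-1 * s)) is left H then projT1 (cid (moved_point H)) else x.

Lemma actE s x e : x (s^-1 * s) -> idem e -> act s x e <-> x (s^-1 * e * s).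
Proof.
rewrite /act; case: pselect => // H _ ee; case: cid => y /= ->.
by split=> [[]|].
Qed.

Lemma point_eq x y : (forall e, idem e -> x e -> y e) -> x = y.
Proof.
move=> xy; apply: point_ext; apply/funext => e; apply/propext; split=> [xe|ye].
  by apply: xy => //; exact: point_idem xe.
have ee := point_idem ye; case: (point_neg x ee) => // xne; exfalso.
by move/(point_negP boolS y ee): (xy _ (idem_neg boolS ee) xne).
Qed.

Lemma point_neqP x y : x <> y -> exists e, [/\ idem e, x e & ~ y e].
Proof.
move=> nxy; apply: contrapT => /forallNP N; apply/nxy/point_eq => e ee xe.
by apply: contrapT => ye; case: (N e).
Qed.

Lemma actM s t x : x (t^-1 * t) -> act t x (s^-1 * s) ->
  act (s * t) x = act s (act t x).
Proof.
move=> xt tx; have xst : x ((s * t)^-1 * (s * t)).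
  by move/(actE xt (idem_mulVg s)): tx; rewrite invgM !mulgA.
apply: point_eq => e ee /(actE xst ee) H; apply/actE => //.
apply/actE => //; first exact: idem_conjV.
by rewrite invgM !mulgA in H *.
Qed.

Lemma act_idem e x : x e -> act e x = x.
Proof.
move=> xe; have ee := point_idem xe.
have xV : x (e^-1 * e) by rewrite idemV // ee.
symmetry; apply: point_eq => f ff xf; apply/actE => //.
by rewrite idemV //; apply/pointM => //; [exact: idemM|split=> //; apply/pointM].
Qed.

(** The action depends only on the germ of [s] at [x]. *)
Lemma act_mulg_idem s e x : x (s^-1 * s) -> x e -> act (s * e) x = act s x.
Proof.
move=> xs xe; have ee := point_idem xe.
have xee : x (e^-1 * e) by rewrite idemV // ee.
have ex := act_idem xe; by rewrite actM ?ex.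
Qed.
End Action.

(** * Supports are definable in a locally moving group *)

Section AlgebraicDisjointness.
Variable G : groupType.
Implicit Types f g h k : G.

(** Rubin's algebraic disjointness, stated in the language of groups so that isomorphisms preserve
    it. For locally moving actions, disjoint supports of [f] and [g] imply it, and it implies
    disjoint supports of [f] and [g ^+ 12]. *)
Definition alg_disjoint f g : Prop := forall h, ~ commute f h ->
  exists f1 f2, [/\ commute f1 g, commute f2 g, [~ f1, [~ f2, h]] <> 1 &
    commute [~ f1, [~ f2, h]] g].

(** The power 12 is the one in [disjoint_of_alg_disjoint]; the geometric meaning is
    [alg_dominatesP]. *)
Definition alg_dominates f k : Prop :=
  forall g, alg_disjoint f g -> commute k (g ^+ 12).
End AlgebraicDisjointness.

(** * Invariance under group isomorphisms *)

Section AlgebraicTransfer.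
Variables (G H : groupType) (phi : UMagmaMorphism.type G H) (psi : H -> G).
Hypotheses (phiK : cancel phi psi) (psiK : cancel psi phi).
Implicit Types f g h k : G.

Lemma commute_iso f g : commute (phi f) (phi g) <-> commute f g.
Proof.
rewrite /commute -!gmulfM; split=> [|->//].
exact: can_inj phiK _ _.
Qed.

Lemma alg_disjoint_iso f g : alg_disjoint (phi f) (phi g) <-> alg_disjoint f g.
Proof.
have ker k : phi k = 1 <-> k = 1.
  have p1 : phi 1 = 1 by exact: gmulf1.
  by split=> [|->//]; rewrite -{1}p1 => /(can_inj phiK).
split=> D h; last first.
  rewrite -(psiK h) => /commute_iso/D[f1 [f2 [c1 c2 k1 ck]]].
  exists (phi f1), (phi f2); rewrite -!gmulfR; split; try exact/commute_iso.
  by move/ker.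
move=> /commute_iso/D[f1 [f2]].
rewrite -(psiK f1) -(psiK f2) -!gmulfR => -[/commute_iso c1 /commute_iso c2 k1].
move/commute_iso => ck; exists (psi f1), (psi f2); split=> //.
by move/ker.
Qed.

Lemma alg_dominates_iso f k : alg_dominates (phi f) (phi k) <-> alg_dominates f k.
Proof.
split=> D g; first by move/alg_disjoint_iso/D; rewrite -gmulfXn => /commute_iso.
by rewrite -(psiK g) => /alg_disjoint_iso/D; rewrite -gmulfXn => /commute_iso.
Qed.
End AlgebraicTransfer.

(** * Locally moving actions *)

Section Rubin.
Variables (G : groupType) (X : Type) (act : G -> X -> X) (B : set (set X)).
Implicit Types (f g h k : G) (x y z : X) (U V : set X).

Definition supp g : set X := [set x | act g x <> x].

Hypothesis act1 : forall x, act 1 x = x.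
Hypothesis actM : forall g h x, act (g * h) x = act g (act h x).
Hypothesis act_faithful : forall g, supp g = set0 -> g = 1.
Hypothesis BI : forall U V, B U -> B V -> B (U `&` V).
Hypothesis B_moved : forall g x, supp g x ->
  exists U, [/\ B U, U x & forall y, U y -> ~ U (act g y)].
Hypothesis B_order12 : forall U, B U -> U !=set0 ->
  exists2 g, supp g `<=` U & supp (g ^+ 12) !=set0.

Lemma actK g : cancel (act g) (act g^-1).
Proof. by move=> x; rewrite -actM mulVg act1. Qed.

Lemma act_eq g h : (forall x, act g x = act h x) -> g = h.
Proof.
move=> gh; apply/divg1_eq/act_faithful; apply/seteqP; split=> // x; case.
by rewrite actM gh -actM mulgV act1.
Qed.

Lemma fixV g x : act g x = x -> act g^-1 x = x.
Proof. by move=> gx; rewrite -{1}gx actK. Qed.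

Lemma fixX g n x : act g x = x -> act (g ^+ n) x = x.
Proof. by move=> gx; elim: n => [|n IH]; rewrite ?expgS ?actM ?IH. Qed.

Lemma suppX g n : supp (g ^+ n) `<=` supp g.
Proof. by move=> x; apply: contra_not; exact: fixX. Qed.

Lemma supp_commute g h x : commute g h -> supp g x -> supp g (act h x).
Proof.
by move=> gh gx; rewrite /supp /= -actM gh actM => /(can_inj (actK h)).
Qed.

Lemma disjoint_supp_commute f g : supp f `&` supp g = set0 -> commute f g.
Proof.
move=> fg0; apply: act_eq => x; rewrite !actM.
have disj y : supp f y -> act g y = y.
  move=> fy; apply: contrapT => gy.
  by have : (supp f `&` supp g) y by []; rewrite fg0.
have [fx|fx] := pselect (act f x = x).
  rewrite fx; have [gx|gx] := pselect (act g x = x); first by rewrite gx.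
  apply: contrapT => /disj gg; apply: gx.
  exact: can_inj (actK g) _ _ gg.
by rewrite (disj x fx) disj //; exact: (supp_commute (commute_refl f)).
Qed.

(** If [h] commuted with [g] it would preserve the support of [g], but it pushes [U] off itself. *)
Lemma noncommute_local U g h x : supp g x -> (forall y, U y -> ~ U (act h y)) ->
  supp g `<=` U -> ~ commute h g.
Proof.
move=> gx hU gU hg; have /gU Uhx := supp_commute (commute_sym hg) gx.
exact: hU (gU _ gx) Uhx.
Qed.

(** Take [g] supported in [U], then [h] supported in a smaller set that [g] pushes off itself. *)
Lemma local_noncommute U : B U -> U !=set0 ->
  exists f1 f2, [/\ supp f1 `<=` U, supp f2 `<=` U & ~ commute f1 f2].
Proof.
move=> BU U0; have [g gU [x /suppX gx]] := B_order12 BU U0.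
have [V [BV Vx gV]] := B_moved gx.
have [|h hUV [y /suppX hy]] := B_order12 (BI BU BV).
  by exists x; split=> //; exact: gU.
exists g, h; split=> //; first by move=> z /hUV[].
by apply: (noncommute_local hy gV) => z /hUV[].
Qed.

(** As [h] does not commute with [f], their supports meet. Near a common point take noncommuting
    [f1] and [f2], supported in a set that both [f] and [h] push off itself. *)
Lemma alg_disjoint_of_disjoint f g : supp f `&` supp g = set0 -> alg_disjoint f g.
Proof.
move=> fg0 h nfh.
have [x [fx hx]] : exists x, supp f x /\ supp h x.
  apply: contrapT => /forallNP N; apply/nfh/disjoint_supp_commute.
  by apply/seteqP; split=> // x [? ?]; apply: (N x).
have [U [BU Ux fU]] := B_moved fx; have [V [BV Vx hV]] := B_moved hx.
have [|f1 [f2 [f1W f2W nc]]] := local_noncommute (BI BU BV); first by exists x.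
have comg k : supp k `<=` U `&` V -> commute k g.
  move=> kW; apply: disjoint_supp_commute; apply/seteqP; split=> // y [ky gy].
  have [Uy _] := kW y ky.
  have : (supp f `&` supp g) y by split=> // fy; apply: (fU y Uy); rewrite fy.
  by rewrite fg0.
have comw k : supp k `<=` U `&` V -> commute k (f2 ^ h).
  move=> kW; apply: disjoint_supp_commute; apply/seteqP; split=> // y [/kW[_ Vy] wy].
  have : supp f2 (act h y).
    by move=> E; apply: wy; rewrite conjgE !actM E actK.
  by move=> /f2W[_]; exact: hV.
have [cw1 cw2] := (comw _ f1W, comw _ f2W); have [c1 c2] := (comg _ f1W, comg _ f2W).
(* The support of [f2 ^ h] misses [V], so this factor commutes with [f1] and [f2] and drops out. *)
have kE : [~ f1, [~ f2, h]] = [~ f1, f2^-1].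
  rewrite (commgEl f2 h) !commgEl; congr (_ * _); rewrite conjgM.
  have cw : commute (f1 ^ f2^-1) (f2 ^ h).
    apply/commute_sym; rewrite (conjgE f1) invgK.
    by do ?apply: commuteM; try apply: commuteV; exact: commute_sym.
  by rewrite [LHS]conjgE cw mulKg.
exists f1, f2; rewrite kE; split=> //.
  move/eqP/commgP => cV; apply: nc; rewrite -[f2]invgK; exact: commuteV.
apply/commute_sym; rewrite commgEl conjgE invgK.
by do ?apply: commuteM; try apply: commuteV; exact: commute_sym.
Qed.

(** The commutator is a conjugate of [h^-1] by [f], times [h]. *)
Lemma supp_commutator f h U : supp h `<=` U ->
  supp [~ f, h] `<=` U `|` act f @^-1` U.
Proof.
move=> hU y; apply: contra_notP => /not_orP[yU fyU] /=.
have hy : act h y = y by apply: contrapT => /hU.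
have hfy : act h (act f y) = act f y by apply: contrapT => /hU.
by rewrite commgEl conjgE !actM hy (fixV hfy) actK.
Qed.

(* The double commutator is supported on four translates of V by elements
   commuting with g.  As 12 is a multiple of 1, 2, 3 and 4, a point moved by
   g ^+ 12 has a g-orbit of at least five points: by pigeonhole two of them
   lie in the same translate. *)
Lemma disjoint_of_alg_disjoint f g : alg_disjoint f g ->
  supp f `&` supp (g ^+ 12) = set0.
Proof.
move=> fg; apply/seteqP; split=> // x [fx gx].
have gkx (n : nat) : (n %| 12)%N -> supp (g ^+ n) x.
  by move=> /dvdnP[m E]; move: gx; rewrite E mulnC expgnA; exact: suppX.
have [U [BU Ux fU]] := B_moved fx.
have [U1 [BU1 U1x gU1]] := B_moved (gkx 1%N isT).
have [U2 [BU2 U2x gU2]] := B_moved (gkx 2%N isT).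
have [U3 [BU3 U3x gU3]] := B_moved (gkx 3%N isT).
have [U4 [BU4 U4x gU4]] := B_moved (gkx 4%N isT).
pose V := U `&` U1 `&` U2 `&` U3 `&` U4.
have BV : B V by do !apply: BI.
have V0 : V !=set0 by exists x.
have fV y : V y -> ~ V (act f y) by case=> [[[[/fU fy _] _] _] _] [[[[]]]].
have gV (n : nat) y : (0 < n < 5)%N -> V y -> ~ V (act (g ^+ n) y).
  move=> kb [[[[_ y1] y2] y3] y4] [[[[_ z1] z2] z3] z4]; move: kb z1 z2 z3 z4.
  case: n => [|[|[|[|[|//]]]]] // _;
    by [move/gU1: y1|move/gU2: y2|move/gU3: y3|move/gU4: y4].
have [h hV [y /suppX hy]] := B_order12 BV V0.
have [f1 [f2 [c1 c2 k1 ck]]] := fg h (noncommute_local hy fV hV).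
set k := commg _ _ in k1 ck.
have [z kz] : exists z, supp k z.
  by apply: contrapT => /forallNP N; apply/k1/act_faithful/seteqP; split=> // z /N.
have kgz i : supp k (act (g ^+ i) z) by apply: supp_commute => //; exact: commuteX.
(* By [supp_commutator], used twice, the preimages of [V] under these elements cover the support of
   [k]. *)
pose v := [tuple 1; f2; f1; f2 * f1].
have cv i : commute g (tnth v i).
  have [cg1 cg2] := (commute_sym c1, commute_sym c2).
  rewrite (tnth_nth 1); case: i => -[|[|[|[|//]]]] ? //=; first exact: commute1.
  exact: commuteM.
have cover u : supp k u -> exists i, V (act (tnth v i) u).
  move=> /(supp_commutator (supp_commutator hV)) [[]|[]] Vu.
  - by exists (inord 0%N); rewrite (tnth_nth 1) inordK //= act1.
  - by exists (inord 1%N); rewrite (tnth_nth 1) inordK.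
  - by exists (inord 2%N); rewrite (tnth_nth 1) inordK.
  - by exists (inord 3%N); rewrite (tnth_nth 1) inordK //= actM.
pose c (i : 'I_5) := projT1 (cid (cover _ (kgz i))).
have cP i : V (act (tnth v (c i)) (act (g ^+ i) z)) by rewrite /c; case: cid.
have [i [j [ij cij]]] : exists i j : 'I_5, (i < j)%N /\ c i = c j.
  apply: contrapT => N; have /leq_card : injective c; last by rewrite !card_ord.
  move=> i j cij; apply: contrapT => /eqP; rewrite neq_ltn => /orP[ij|ij].
    by apply: N; exists i, j.
  by apply: N; exists j, i.
(* Two orbit points in one translate make [g ^+ (j - i)] send a point of [V] into [V], with [j - i]
   between 1 and 4. *)
have := cP j; rewrite -cij -(subnK (ltnW ij)) expgnDr actM -(actM (tnth v (c i))).
rewrite (commuteX (j - i) (commute_sym (cv (c i)))) actM.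
apply: gV (cP i); rewrite subn_gt0 ij /=.
by rewrite (leq_ltn_trans (leq_subr _ _)) //; exact: ltn_ord.
Qed.

(* In other words, supp k lies in the closure of supp f. *)
Lemma alg_dominatesP f k : alg_dominates f k <->
  forall U, B U -> U `&` supp f = set0 -> U `&` supp k = set0.
Proof.
split=> [D U BU Uf|D g /disjoint_of_alg_disjoint fg].
  (* If [k] moves a point of [U], some [g] supported near it has a 12th power that does not commute
     with [k], although its support misses that of [f]. *)
  apply/seteqP; split=> // x [Ux kx]; have [V [BV Vx kV]] := B_moved kx.
  have [|g gUV [y gy]] := B_order12 (BI BU BV); first by exists x.
  have [gU gV] : supp g `<=` U /\ supp g `<=` V by split=> z /gUV[].
  have : commute k (g ^+ 12).
    apply/D/alg_disjoint_of_disjoint; apply/seteqP; split=> // z [fz /gU Uz].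
    by rewrite -Uf.
  by apply: (noncommute_local gy kV) => z /suppX/gV.
apply/disjoint_supp_commute/seteqP; split=> // x [kx gx].
have [U [BU Ux gU]] := B_moved gx.
have Ug : U `<=` supp (g ^+ 12) by move=> y Uy E; apply: (gU y Uy); rewrite E.
have Uk : U `&` supp k = set0.
  apply: D => //; apply/seteqP; split=> // y [Uy fy].
  by rewrite -fg; split=> //; exact: Ug.
by rewrite -Uk.
Qed.
End Rubin.

(** * The action of the group of units *)

Lemma tarski_boolean (S : inverseMonoidType) : simple_tarski S ->
  boolean_inverse_monoid S.
Proof. by case=> _ _ []. Qed.

Section UnitAction.
Variable S : inverseMonoidType.
Hypothesis tarskiS : simple_tarski S.
Implicit Types (a b e f s t u w : S) (x y z : stone_point S) (g h k : units S).

Let boolS := tarski_boolean tarskiS.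

Definition unit_act g x := act boolS (g : S) x.

Lemma unit_val_mulVg g : (g : S)^-1 * (g : S) = 1.
Proof. exact: invertible_mulVg (unit_valP g). Qed.

Lemma unit_val_mulgV g : (g : S) * (g : S)^-1 = 1.
Proof. exact: invertible_mulgV (unit_valP g). Qed.

Lemma point_unit g x : x ((g : S)^-1 * (g : S)).
Proof. by rewrite unit_val_mulVg; exact: point1. Qed.

Lemma unit_actE g x e : idem e -> unit_act g x e <-> x ((g : S)^-1 * e * (g : S)).
Proof. exact: actE (point_unit g x). Qed.

Lemma unit_act1 x : unit_act 1 x = x.
Proof. exact: act_idem (point1 x). Qed.

Lemma unit_actM g h x : unit_act (g * h) x = unit_act g (unit_act h x).
Proof. exact: actM (point_unit h x) (point_unit g _). Qed.

Lemma unit_act_conj g x e : idem e ->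
  unit_act g x ((g : S) * e * (g : S)^-1) <-> x e.
Proof.
move=> ee; rewrite unit_actE; last exact: idem_conj.
by rewrite !mulgA unit_val_mulVg mul1g -mulgA unit_val_mulVg mulg1.
Qed.

Lemma fundamental_points s t :
  (forall e x, idem e -> x (s * e * s^-1) <-> x (t * e * t^-1)) -> s = t.
Proof.
move=> st; apply: (fundamental tarskiS) => e ee.
by apply: (idem_eq_points boolS) => [||x]; [exact: idem_conj|exact: idem_conj|exact: st].
Qed.

(** A unit fixing every point of [neg w] acts there like the idempotent [neg w], so
    [fundamental_points] identifies their restrictions. Supports become equations in [S]. *)
Lemma supp_subP g w : idem w ->
  supp unit_act g `<=` [set x | x w] <-> (g : S) * neg w = neg w.
Proof.
move=> ww; have nw := idem_neg boolS ww; split=> [sub|gw x]; last first.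
  apply: contra_notP => /(point_negP boolS x ww) xn.
  rewrite /unit_act -(act_mulg_idem boolS (point_unit g x) xn) gw.
  exact: act_idem xn.
have fix_nw x : x (neg w) -> unit_act g x = x.
  by move/(point_negP boolS x ww) => nx; apply: contrapT => /sub.
apply: fundamental_points => e x ee; have ew := idemM (idemM nw ee) nw.
have -> : (g : S) * neg w * e * ((g : S) * neg w)^-1
        = (g : S) * (neg w * e * neg w) * (g : S)^-1.
  by rewrite invgM (idemV nw) !mulgA.
rewrite (idemV nw); set k := neg w * e * neg w in ew *.
have kw y : y k -> y (neg w) by case/pointM=> //; exact: idemM.
split=> xk; last by have /fix_nw <- := kw _ xk; exact/unit_act_conj.
pose y := unit_act g^-1 x; have xE : x = unit_act g y.
  by rewrite -unit_actM mulgV unit_act1.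
have yk : y k by apply/(unit_act_conj g) => //; rewrite -xE.
by rewrite xE (fix_nw _ (kw _ yk)).
Qed.

Lemma unit_act_faithful g : supp unit_act g = set0 -> g = 1.
Proof.
move=> g0; apply: val_inj => /=.
have : supp unit_act g `<=` [set x | x 0] by rewrite g0.
move/(supp_subP _ (idem0 S)).
have -> : neg (0 : S) = 1; last by rewrite mulg1.
by have /(mulg_negP boolS 1 (idem0 S)) := mulg0 (1 : S); rewrite mul1g.
Qed.

Definition clopen (U : set (stone_point S)) : Prop :=
  exists2 e : S, idem e & U = [set x | x e].

Lemma clopenI U V : clopen U -> clopen V -> clopen (U `&` V).
Proof.
move=> [e ee ->] [f ff ->]; exists (e * f); first exact: idemM.
by apply/seteqP; split=> x /=; [move=> [? ?]; apply/pointM|case/pointM].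
Qed.

(** Choose [e] containing [x] but not its image, and remove from [e] its own preimage. *)
Lemma clopen_moved g x : supp unit_act g x ->
  exists U, [/\ clopen U, U x & forall y, U y -> ~ U (unit_act g y)].
Proof.
move=> /nesym/(point_neqP boolS)[e [ee xe gxe]].
have kk := idem_conjV (g : S) ee; have nk := idem_neg boolS kk.
exists [set y | y (e * neg ((g : S)^-1 * e * (g : S)))]; split.
- by exists (e * neg ((g : S)^-1 * e * (g : S))) => //; exact: idemM.
- apply/pointM => //; split=> //; apply/(point_negP boolS) => //.
  by move/unit_actE; apply: contra_not gxe; apply.
- move=> y /pointM[] // ye /(point_negP boolS y kk) yk /pointM[] //.
  by move/(unit_actE g y ee).
Qed.

(** Near [x], [s] carries a small [u] to an idempotent disjoint from it; apply [swap_unit] to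
    [s * u]. *)
Lemma swap_at s x w : x (s^-1 * s) -> act boolS s x <> x -> idem w -> x w ->
  act boolS s x w -> exists g u, [/\ x u, (g : S) * u = s * u, g * g = 1 &
    supp unit_act g `<=` [set y | y w]].
Proof.
move=> xs /nesym/(point_neqP boolS)[e [ee xe]] + ww xw.
rewrite (actE boolS xs ee) (actE boolS xs ww) => sxe sxw.
have ss := idem_mulVg s; have [ke kw] := (idem_conjV s ee, idem_conjV s ww).
have nke := idem_neg boolS ke.
(* Points of [p] lie in [e] and are sent outside it; points of [q] lie in [w] and stay there. *)
have [p [pp xp pe pke]] : exists p, [/\ idem p, x p, p * e = p & p * (s^-1 * e * s) = 0].
  exists (e * neg (s^-1 * e * s)); split; first exact: idemM.
  - by apply/pointM => //; split=> //; apply/(point_negP boolS).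
  - by rewrite -mulgA (idemC nke ee) mulgA ee.
  - by rewrite -mulgA neg_mulg // mulg0.
have [q [qq xq qw qkw]] : exists q, [/\ idem q, x q, q * w = q & q * (s^-1 * w * s) = q].
  exists (w * (s^-1 * w * s)); split; first exact: idemM.
  - exact/pointM.
  - by rewrite -mulgA (idemC kw ww) mulgA ww.
  - by rewrite -mulgA kw.
have [u [uu xu su up uq]] :
    exists u, [/\ idem u, x u, s^-1 * s * u = u, u * p = u & u * q = u].
  have pq := idemM pp qq; exists (s^-1 * s * (p * q)); split.
  - exact: idemM.
  - by apply/pointM => //; split=> //; apply/pointM.
  - by rewrite mulgA ss.
  - by rewrite -mulgA -(mulgA p) (idemC qq pp) (mulgA p p) pp.
  - by rewrite -mulgA -(mulgA p) qq.
have ue : u * e = u by rewrite -up -mulgA pe.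
have une : (s^-1 * e * s) * u = 0 by rewrite (idemC ke uu) -up -mulgA pke mulg0.
have uw : u * w = u by rewrite -uq -mulgA qw.
have ukw : (s^-1 * w * s) * u = u by rewrite (idemC kw uu) -uq -mulgA qkw.
have aE : (s * u)^-1 * (s * u) = u.
  by rewrite invgM (idemV uu) -mulgA (mulgA s^-1) su uu.
have esu : e * (s * u) = 0 by rewrite mulgA (idem_mulg s ee) -mulgA une mulg0.
have [|g [gg ga gw]] := swap_unit boolS (a := s * u).
  by rewrite aE -{1}ue -(mulgA u) (mulgA e) esu mul0g mulg0.
have gU : invertible g by apply/invertibleP; exists g.
exists (Unit gU), u; split=> //; first by rewrite -[in LHS]aE ga.
  exact: val_inj.
apply/(supp_subP _ ww); apply: gw => //; first by rewrite -mulgA uw.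
by rewrite mulgA (idem_mulg s ww) -mulgA ukw.
Qed.

Lemma swap_point s x w : x (s^-1 * s) -> act boolS s x <> x -> idem w -> x w ->
  act boolS s x w -> exists g, [/\ unit_act g x = act boolS s x,
    unit_act g (act boolS s x) = x & supp unit_act g `<=` [set y | y w]].
Proof.
move=> xs sx ww xw sxw; have [g [u [xu gu gg gw]]] := swap_at xs sx ww xw sxw.
have gx : unit_act g x = act boolS s x.
  by rewrite /unit_act -(act_mulg_idem boolS (point_unit g x) xu) gu act_mulg_idem.
by exists g; split=> //; rewrite -gx -unit_actM gg unit_act1.
Qed.

Lemma orbit_dense x w : idem w -> w <> 0 ->
  exists2 s, x (s^-1 * s) & act boolS s x w.
Proof.
move=> ww w0; have [a xa] := point_meets_orbit tarskiS x ww w0.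
have xs : x (a^-1^-1 * a^-1).
  rewrite invgK; apply: (point_up xa (idem_mulgV a)).
  by rewrite -!mulgA (mulgA a^-1) mulVgKg.
by exists a^-1 => //; apply/(actE boolS xs ww); rewrite invgK.
Qed.
(** Without atoms, [e] has a nonzero part that does not contain [x]; by density of orbits [x] can be
    moved there, and then by a swap inside [e]. *)
Lemma moved_within x e : x e ->
  exists2 g, supp unit_act g `<=` [set y | y e] & supp unit_act g x.
Proof.
move=> xe; have ee := point_idem xe.
have e0 : e <> 0 by move=> E; case: (@point0 _ x); rewrite -E.
have [f [ff f0 fe xf]] : exists f, [/\ idem f, f <> 0, f * e = f & ~ x f].
  have [v [vv ev env]] := atomless tarskiS ee e0; have nv := idem_neg boolS vv.
  have [xv|xv] := pselect (x v).
    exists (e * neg v); split=> //; first exact: idemM.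
      by rewrite idemC ?mulgA ?ee //; exact: idemM.
    by case/pointM => // _ /(point_negP boolS x vv).
  exists (e * v); split=> //; first exact: idemM.
    by rewrite idemC ?mulgA ?ee //; exact: idemM.
  by case/pointM.
have [s xs sxf] := orbit_dense x ff f0.
have sx : act boolS s x <> x by move=> E; apply: xf; rewrite -E.
have [g [gx _ ge]] := swap_point xs sx ee xe (point_up sxf ee fe).
by exists g => //; rewrite /supp /= gx.
Qed.

(** Iterate [atomless]. Indices run from 0 to [n] inclusive, so there are [n.+1] pieces. *)
Lemma split_idem n e : idem e -> e <> 0 -> exists W : nat -> S,
  (forall i, (i <= n)%N -> [/\ idem (W i), W i <> 0 & W i * e = W i]) /\
  (forall i j, (i < j <= n)%N -> W i * W j = 0).
Proof.
elim: n e => [|n IH] e ee e0.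
  by exists (fun _ => e); split=> // i j /andP[+ j0]; rewrite ltnNge (leq_trans j0).
have [v [vv ev env]] := atomless tarskiS ee e0; have nv := idem_neg boolS vv.
have env' := idemM ee nv.
have [W [WP Wd]] := IH _ env' env.
exists (fun i => if i is i'.+1 then W i' else e * v); split=> [[|i] ni|[|i] [|j] //].
- by split=> //; [exact: idemM|rewrite (idemC ee vv) -mulgA ee].
- have [W1 W2 W3] := WP i ni; split=> //.
  by rewrite -W3 (idemC ee nv) -!mulgA ee.
- move=> /(WP j)[W1 W2 <-]; rewrite (idemC W1 env') mulgA.
  rewrite -(mulgA e) (mulgA v) (idemC vv ee) -!mulgA (mulgA v) mulg_neg //.
  by rewrite mul0g !mulg0.
- exact: Wd.
Qed.

(* A product of four swaps acting as a 5-cycle on points x, x1, ..., x4. *)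
Lemma order12_within U : clopen U -> U !=set0 ->
  exists2 g, supp unit_act g `<=` U & supp unit_act (g ^+ 12) !=set0.
Proof.
move=> [e ee ->] [x0 xe].
have e0 : e <> 0 by move=> E; case: (@point0 _ x0); rewrite -E.
have [W [WP Wd]] := split_idem 4 ee e0.
have [W0i W00 W0e] := WP 0%N isT; have [x xW] := point_mem boolS W0i W00.
have Wdis y i j : (i <= 4)%N -> (j <= 4)%N -> i <> j -> y (W i) -> ~ y (W j).
  move=> i4 j4 /eqP ij yi yj; case: (@point0 _ y).
  have [Wi _ _] := WP i i4; have [Wj _ _] := WP j j4.
  have := ij; rewrite neq_ltn => /orP[lt|lt].
    by rewrite -(Wd i j) ?lt //; apply/pointM.
  by rewrite -(Wd j i) ?lt //; apply/pointM.
have swaps i : (0 < i <= 4)%N -> exists y g, [/\ y (W i), unit_act g x = y,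
    unit_act g y = x, supp unit_act g `<=` [set z | z e] &
    forall z j, (0 < j <= 4)%N -> i <> j -> z (W j) -> unit_act g z = z].
  case/andP=> i0 i4; have [Wi Wi0 Wie] := WP i i4.
  have [s xs sxi] := orbit_dense x Wi Wi0.
  have i_neq0 : i <> 0%N by move=> E; rewrite E in i0.
  have sx : act boolS s x <> x.
    by move=> E; rewrite E in sxi; apply: Wdis sxi xW.
  have [n0 ni] := (idem_neg boolS W0i, idem_neg boolS Wi).
  (* The join of the two pieces, which confines the swap. *)
  pose w := neg (neg (W 0%N) * neg (W i)).
  have nn := idemM n0 ni; have ww : idem w by exact: idem_neg.
  have wP z : z w <-> z (W 0%N) \/ z (W i).
    rewrite (point_negP boolS z nn) (pointM z n0 ni).
    rewrite (point_negP boolS z W0i) (point_negP boolS z Wi).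
    by split=> [/not_andP[]/contrapT|[? []|? []]]; auto.
  have [g [gx gy gw]] := swap_point xs sx ww (proj2 (wP x) (or_introl xW))
    (proj2 (wP _) (or_intror sxi)).
  exists (act boolS s x), g; split=> //.
    by move=> z /gw/wP[] zW; apply: (point_up zW).
  move=> z j /andP[j0 j4] ij zj; apply: contrapT => /gw/wP[] zW.
    by apply: Wdis zW zj => // E; rewrite -E in j0.
  exact: Wdis zW zj.
have [x1 [g1 [W1 g1x g1y g1e g1z]]] := swaps 1%N isT.
have [x2 [g2 [W2 g2x g2y g2e g2z]]] := swaps 2%N isT.
have [x3 [g3 [W3 g3x g3y g3e g3z]]] := swaps 3%N isT.
have [x4 [g4 [W4 g4x g4y g4e g4z]]] := swaps 4%N isT.
pose g := g4 * (g3 * (g2 * g1)).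
have gE z : unit_act g z = unit_act g4 (unit_act g3 (unit_act g2 (unit_act g1 z))).
  by rewrite !unit_actM.
exists g.
  move=> z; apply: contra_notP => ze; rewrite gE.
  have fixz h : supp unit_act h `<=` [set y | y e] -> unit_act h z = z.
    by move=> he; apply: contrapT => /he.
  by rewrite !fixz.
have gx0 : unit_act g x = x1.
  by rewrite gE g1x (g2z _ 1%N) ?(g3z _ 1%N) ?(g4z _ 1%N).
have gx1 : unit_act g x1 = x2.
  by rewrite gE g1y g2x (g3z _ 2%N) ?(g4z _ 2%N).
have gx2 : unit_act g x2 = x3.
  by rewrite gE (g1z _ 2%N) ?g2y ?g3x ?(g4z _ 3%N).
have gx3 : unit_act g x3 = x4.
  by rewrite gE (g1z _ 3%N) ?(g2z _ 3%N) ?g3y ?g4x.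
have gx4 : unit_act g x4 = x.
  by rewrite gE (g1z _ 4%N) ?(g2z _ 4%N) ?(g3z _ 4%N).
(* On the 5-cycle the 12th power is the square, as 12 is 2 modulo 5. *)
exists x; rewrite /supp /= (_ : unit_act (g ^+ 12) x = x2).
  by move=> E; rewrite E in W2; exact: Wdis W2 xW.
rewrite !expgS expg0 !(unit_actM g) unit_act1.
by rewrite !(gx0, gx1, gx2, gx3, gx4).
Qed.

Lemma unit_alg_dominatesP g h : alg_dominates g h <->
  forall U, clopen U -> U `&` supp unit_act g = set0 ->
    U `&` supp unit_act h = set0.
Proof.
apply: (alg_dominatesP (act := unit_act)); [exact: unit_act1|exact: unit_actM|
  exact: unit_act_faithful|exact: clopenI|exact: clopen_moved|exact: order12_within].
Qed.

(** A unit moving a point of [e] fails to commute with some unit supported in a small piece around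
    it. This makes complements visible to the group. *)
Lemma centralizer_local g e : idem e ->
  supp unit_act g `<=` [set x | x (neg e)] <->
  forall h, supp unit_act h `<=` [set x | x e] -> commute h g.
Proof.
move=> ee; split=> [sub h he|cent x gx].
  apply: (disjoint_supp_commute unit_act1 unit_actM unit_act_faithful).
  apply/seteqP; split=> // x [/he xe /sub].
  by move/(point_negP boolS x ee).
apply/(point_negP boolS x ee) => xe.
have [U [Uc Ux gU]] := clopen_moved gx.
have [|h hU [y hy]] := order12_within (clopenI Uc (ex_intro2 _ _ e ee erefl)).
  by exists x.
have hU' : supp unit_act h `<=` U by move=> z /hU[].
have {}hy := suppX unit_act1 unit_actM hy.
apply: (noncommute_local unit_act1 unit_actM hy gU hU').
by apply/commute_sym/cent => z /hU[].
Qed.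

(* This is where meets are used: p is the complement of the meet of g and 1, and
   the points below p form the closure of the support of g. *)
Lemma support_exists g : exists2 p : S, idem p &
  forall w, idem w -> supp unit_act g `<=` [set x | x w] <-> p * w = p.
Proof.
case: tarskiS => _ _ [_ /(_ g 1)[m [mg m1 mP]]].
have [mm _] := proj1 (natural_le_idem _ (idem1 S)) m1.
have nm := idem_neg boolS mm.
have gm : (g : S) * m = m by rewrite [RHS](natural_leP mg) (idemV mm) mm.
exists (neg m) => // w ww; have nw := idem_neg boolS ww.
rewrite supp_subP // -(mulg_neg_eq0 boolS (neg m) ww) (neg_mulg_eq0 boolS _ mm).
split=> [gw|<-]; last by rewrite mulgA gm.
suff /(natural_le_idem _ mm)[] : natural_le (neg w) m by [].
by apply: mP; exists (neg w); rewrite ?mul1g.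
Qed.

Lemma alg_dominates_support g k p : idem p ->
  (forall w, idem w -> supp unit_act g `<=` [set x | x w] <-> p * w = p) ->
  alg_dominates g k <-> supp unit_act k `<=` [set x | x p].
Proof.
move=> pp pP; have np := idem_neg boolS pp; rewrite unit_alg_dominatesP.
split=> [D x kx|kp _ [e ee ->] ge].
  apply: contrapT => /(point_negP boolS x pp) xn.
  have gp : supp unit_act g `<=` [set x | x p] by apply/pP.
  have nk : [set y : stone_point S | y (neg p)] `&` supp unit_act k = set0.
    apply: D; first by exists (neg p).
    by apply/seteqP; split=> // y [/(point_negP boolS y pp) yp /gp].
  have : ([set y : stone_point S | y (neg p)] `&` supp unit_act k) x by [].
  by rewrite nk.
have ne := idem_neg boolS ee.
have pe : p * neg e = p.
  apply/pP => // x gx; apply/(point_negP boolS x ee) => xe.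
  suff : ([set y : stone_point S | y e] `&` supp unit_act g) x by rewrite ge.
  by [].
apply/seteqP; split=> // x [xe /kp xp].
by have /(point_negP boolS x ee) := point_up xp ne pe.
Qed.

Lemma supp_conj g k e : idem e ->
  supp unit_act k `<=` [set x | x ((g : S) * e * (g : S)^-1)] <->
  supp unit_act (g^-1 * k * g) `<=` [set x | x e].
Proof.
move=> ee; split=> sub x kx.
  apply/(unit_act_conj g x ee)/sub; apply: contra_not kx => kx.
  by rewrite !unit_actM kx -unit_actM mulVg unit_act1.
have xE : x = unit_act g (unit_act g^-1 x) by rewrite -unit_actM mulgV unit_act1.
rewrite /= xE; apply/unit_act_conj => //; apply: sub; apply: contra_not kx.
rewrite !unit_actM -[unit_act g (unit_act g^-1 x)]unit_actM mulgV unit_act1 => E.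
exact: can_inj (actK unit_act1 unit_actM g^-1) _ _ E.
Qed.
End UnitAction.

(** * Reconstruction of the monoid *)

Section Matching.
Variables (S T : inverseMonoidType).
Hypotheses (tarskiS : simple_tarski S) (tarskiT : simple_tarski T).

(** Correspondence of rigid stabilizers under [phi]. It is a relation because the existence of
    partners is only established in [matching_total]. *)
Definition matching (phi : units S -> units T) (e : S) (e' : T) : Prop :=
  [/\ idem e, idem e' & forall g,
    supp (unit_act tarskiS) g `<=` [set x | x e] <->
    supp (unit_act tarskiT) (phi g) `<=` [set x | x e']].

(* Testing for zero products makes compatibility with joins and inverses
   immediate; for matched e and e' it amounts to matching [s * e * s^-1] with
   [t * e' * t^-1]. *)
Definition intertwining (phi : units S -> units T) (s : S) (t : T) : Prop :=
  forall e e' f f', matching phi e e' -> matching phi f f' ->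
    f * s * e = 0 <-> f' * t * e' = 0.
End Matching.

Section MatchingSym.
Variables (S T : inverseMonoidType).
Hypotheses (tarskiS : simple_tarski S) (tarskiT : simple_tarski T).
Variables (phi : units S -> units T) (psi : units T -> units S).
Hypotheses (phiK : cancel phi psi) (psiK : cancel psi phi).

Lemma matching_sym e e' :
  matching tarskiS tarskiT phi e e' <-> matching tarskiT tarskiS psi e' e.
Proof.
split=> -[ee ee' E]; split=> // g; apply: iff_sym.
  by have := E (psi g); rewrite psiK.
by have := E (phi g); rewrite phiK.
Qed.

Lemma intertwining_sym s t :
  intertwining tarskiS tarskiT phi s t -> intertwining tarskiT tarskiS psi t s.
Proof.
move=> st e e' f f' /matching_sym me /matching_sym mf; apply: iff_sym.
exact: st me mf.
Qed.
End MatchingSym.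

Lemma inverse_morphism (G H : monoidType) (phi : UMagmaMorphism.type G H) :
  bijective phi ->
  exists psi : UMagmaMorphism.type H G, cancel phi psi /\ cancel psi phi.
Proof.
case=> psi phiK psiK; have psiM := can2_gmulfM phiK psiK.
have psi1 := can2_gmulf1 phiK psiK.
pose m := isUMagmaMorphism.Build H G psi (conj psi1 psiM).
by pose Psi : UMagmaMorphism.type H G := HB.pack psi m; exists Psi.
Qed.

Section MatchingFun.
Variables (S T : inverseMonoidType).
Hypotheses (tarskiS : simple_tarski S) (tarskiT : simple_tarski T).
Variables (phi : units S -> units T) (psi : units T -> units S).
Hypotheses (phiK : cancel phi psi) (psiK : cancel psi phi).

(** A point of [e1] is moved by a unit supported in [e1]; matching through [e] puts that support
    inside [e2]. *)
Lemma matching_fun e e1 e2 : matching tarskiS tarskiT phi e e1 ->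
  matching tarskiS tarskiT phi e e2 -> e1 = e2.
Proof.
have boolT := tarski_boolean tarskiT.
suff sub f1 f2 : matching tarskiS tarskiT phi e f1 ->
    matching tarskiS tarskiT phi e f2 -> forall x : stone_point T, x f1 -> x f2.
  move=> m1 m2; have [_ i1 _] := m1; have [_ i2 _] := m2.
  by apply: (idem_eq_points boolT) => // x; split; exact: sub.
move=> [_ i1 m1] [_ i2 m2] x x1.
have [g g1 gx] := moved_within tarskiT x1.
have /m2 : supp (unit_act tarskiS) (psi g) `<=` [set x | x e] by apply/m1; rewrite psiK.
by rewrite psiK; apply.
Qed.
End MatchingFun.

Section Reconstruction.
Variables (S T : inverseMonoidType).
Hypotheses (tarskiS : simple_tarski S) (tarskiT : simple_tarski T).
Variables (phi : UMagmaMorphism.type (units S) (units T)).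
Variables (psi : UMagmaMorphism.type (units T) (units S)).
Hypotheses (phiK : cancel phi psi) (psiK : cancel psi phi).
Implicit Types (s : S) (t : T).

Let boolS := tarski_boolean tarskiS.
Let boolT := tarski_boolean tarskiT.
Local Notation match_ := (matching tarskiS tarskiT phi).
Local Notation inter := (intertwining tarskiS tarskiT phi).

Lemma matchingM e e' f f' : match_ e e' -> match_ f f' -> match_ (e * f) (e' * f').
Proof.
move=> [ee ee' mE] [ff ff' mF]; split; [exact: idemM|exact: idemM|move=> g].
have split_mul (R : inverseMonoidType) (A : set (stone_point R)) (a b : R) :
    idem a -> idem b -> A `<=` [set x | x (a * b)] <->
    A `<=` [set x | x a] /\ A `<=` [set x | x b].
  move=> aa bb; split=> [sub|[Aa Ab] x Ax]; last first.
    by apply/pointM => //; split; [exact: Aa|exact: Ab].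
  by split=> x /sub/pointM[].
by rewrite !split_mul // mE mF.
Qed.

(** By [centralizer_local] the rigid stabilizer of a complement is a centralizer, which [phi]
    preserves. *)
Lemma matching_neg e e' : match_ e e' -> match_ (neg e) (neg e').
Proof.
move=> [ee ee' mE]; split; [exact: idem_neg|exact: idem_neg|move=> g].
rewrite !centralizer_local //; split=> cent h he.
  rewrite -(psiK h); apply/(commute_iso phiK)/cent/mE.
  by rewrite psiK.
by apply/(commute_iso phiK)/cent/mE.
Qed.

Lemma matching0 : match_ 0 0.
Proof.
split; [exact: idem0|exact: idem0|move=> g].
have supp0 (R : inverseMonoidType) (tR : simple_tarski R) (h : units R) :
    supp (unit_act tR) h `<=` [set x | x 0] <-> h = 1.
  split=> [sub|-> x]; last by case; exact: unit_act1.
  by apply: (unit_act_faithful (tarskiS := tR)); apply/seteqP; split=> // x /sub/point0.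
rewrite !supp0; split=> [->|E]; first exact: gmulf1.
by apply: (can_inj phiK); rewrite E; apply/esym; exact: gmulf1.
Qed.

Lemma matching_eq0 e e' : match_ e e' -> e = 0 <-> e' = 0.
Proof.
move=> m; split=> E; rewrite E in m.
  exact: matching_fun psiK _ _ _ m matching0.
move/(matching_sym _ _ phiK psiK): m => m.
by apply: (matching_fun phiK m); apply/(matching_sym _ _ phiK psiK)/matching0.
Qed.

Lemma matching_conj (g : units S) e e' : match_ e e' ->
  match_ ((g : S) * e * (g : S)^-1) ((phi g : T) * e' * (phi g : T)^-1).
Proof.
move=> [ee ee' mE]; split; [exact: idem_conj|exact: idem_conj|move=> k].
by rewrite !supp_conj // mE !gmulfM gmulfV.
Qed.

(* J consists of the f for which [f * e] lies below a matched idempotent below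
   e; it contains the closed supports of the units moving points inside e. *)
Lemma matching_total e : idem e -> exists e', match_ e e'.
Proof.
move=> ee; pose J := [set f : S | idem f /\ exists m m', [/\ match_ m m',
  forall x : stone_point S, x m -> x e & forall x : stone_point S, x f -> x e -> x m]].
have [[_ [m [m' [mm me em]]]]|J1] := pselect (J 1).
  have [mi _ _] := mm.
  have -> : e = m; last by exists m'.
  apply: (idem_eq_points boolS) => // x; split=> [xe|/me//].
  by apply: em xe; exact: point1.
have [|x xJ] := @prime_ideal _ boolS J _ J1.
  split=> [|f []//|f g [ff [m [m' [mm me em]]]] gg|g f gg ff [_ [m1 [m1' [mm1 me1 em1]]]]
    [_ [m2 [m2' [mm2 me2 em2]]]]].
  - split; first exact: idem0.
    exists 0, 0; split; [exact: matching0|by move=> x /point0|by move=> x /point0].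
  - split; first exact: idemM.
    by exists m, m'; split=> // x /pointM[] // /em.
  (* Joins, written by de Morgan so that [matching_neg] and [matchingM] apply. *)
  - split=> //; exists (neg (neg m1 * neg m2)), (neg (neg m1' * neg m2')).
    have [[i1 _ _] [i2 _ _]] := (mm1, mm2).
    have [n1 n2] := (idem_neg boolS i1, idem_neg boolS i2).
    have mP (x : stone_point S) : x (neg (neg m1 * neg m2)) <-> x m1 \/ x m2.
      rewrite (point_negP boolS x (idemM n1 n2)) (pointM x n1 n2).
      rewrite (point_negP boolS x i1) (point_negP boolS x i2).
      by split=> [/not_andP[]/contrapT|[? []|? []]]; auto.
    split; first by apply/matching_neg/matchingM; exact: matching_neg.
      by move=> x /mP[/me1|/me2].
    move=> x xg xe; apply/mP; case: (point_neg x ff) => xf; [left|right].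
      by apply: em1 xe; apply/pointM.
    by apply: em2 xe; apply/pointM => //; exact: idem_neg.
have xe : x e.
  apply: contrapT => /(point_negP boolS x ee); apply: xJ.
  split; first exact: idem_neg.
  exists 0, 0; split; [exact: matching0|by move=> y /point0|].
  by move=> y /(point_negP boolS y ee).
(* The closed support [p] of this unit lies below [e], and invariance of [alg_dominates] matches it
   with that of [phi g]; so [p] is in [J] although it contains [x]. *)
have [g ge gx] := moved_within tarskiS xe.
have [p pp pP] := support_exists tarskiS g.
have [p' pp' pP'] := support_exists tarskiT (phi g).
have xp : x p by have /(_ x gx) := proj2 (pP p pp) pp.
case: (xJ p) => //; split=> //; exists p, p'; split=> // [|y yp].
  split=> // k; rewrite -(alg_dominates_support k pp pP).
  by rewrite -(alg_dominates_support (phi k) pp' pP') (alg_dominates_iso phiK psiK).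
exact: point_up yp ee (proj1 (pP e ee) ge).
Qed.
End Reconstruction.

(** * Extension from idempotents and units to all elements *)

Section Intertwining.
Variables (S T : inverseMonoidType).
Hypotheses (tarskiS : simple_tarski S) (tarskiT : simple_tarski T).
Variables (phi : UMagmaMorphism.type (units S) (units T)).
Variables (psi : UMagmaMorphism.type (units T) (units S)).
Hypotheses (phiK : cancel phi psi) (psiK : cancel psi phi).

Let boolS := tarski_boolean tarskiS.
Let boolT := tarski_boolean tarskiT.
Local Notation match_ := (matching tarskiS tarskiT phi).
Local Notation inter := (intertwining tarskiS tarskiT phi).

Lemma matching_surj e' : idem e' -> exists e, match_ e e'.
Proof.
move=> ee'; have [e m] := matching_total tarskiT tarskiS psiK phiK ee'.
by exists e; apply/(matching_sym _ _ phiK psiK).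
Qed.

(** Every idempotent of [T] is matched, so the zero tests give the annihilator of the conjugate and
    [idem_ext] applies. *)
Lemma intertwining_conj s t e e' : inter s t -> match_ e e' ->
  match_ (s * e * s^-1) (t * e' * t^-1).
Proof.
move=> st m; have [ee ee' _] := m; have ses := idem_conj s ee.
have [h' mh] := matching_total tarskiS tarskiT phiK psiK ses.
have [_ hh' _] := mh.
suff <- : h' = t * e' * t^-1 by [].
apply: (idem_ext boolT) => // [|c' cc']; first exact: idem_conj.
have [c mc] := matching_surj cc'.
rewrite -(matching_eq0 phiK psiK (matchingM mc mh)).
by rewrite -!mulg_conj_eq0 //; exact: st.
Qed.

Lemma conj_intertwining s t :
  (forall e e', match_ e e' -> match_ (s * e * s^-1) (t * e' * t^-1)) -> inter s t.
Proof.
move=> st e e' f f' me mf; have [[ee ee' _] [ff ff' _]] := (me, mf).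
rewrite !mulg_conj_eq0 //; apply: (matching_eq0 phiK psiK).
by apply: matchingM => //; exact: st.
Qed.

Lemma intertwining_fun s t1 t2 : inter s t1 -> inter s t2 -> t1 = t2.
Proof.
move=> st1 st2; apply: (fundamental tarskiT) => e' /matching_surj[e m].
exact: (matching_fun psiK (intertwining_conj st1 m) (intertwining_conj st2 m)).
Qed.

Lemma intertwiningM s1 s2 t1 t2 : inter s1 t1 -> inter s2 t2 ->
  inter (s1 * s2) (t1 * t2).
Proof.
move=> st1 st2; apply: conj_intertwining => e e' m.
have := intertwining_conj st1 (intertwining_conj st2 m).
by rewrite !invgM !mulgA.
Qed.

Lemma intertwiningV s t : inter s t -> inter s^-1 t^-1.
Proof.
move=> st e e' f f' me mf; have [[ee ee' _] [ff ff' _]] := (me, mf).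
have flip (R : inverseMonoidType) (a b r : R) : idem a -> idem b ->
    a * r^-1 * b = 0 <-> b * r * a = 0.
  move=> aa bb; split=> /(congr1 (fun z => z^-1));
  by rewrite /= invg0 !invgM ?invgK (idemV aa) (idemV bb) mulgA.
by rewrite !flip //; exact: st.
Qed.

Lemma intertwining_unit (g : units S) : inter (g : S) (phi g : T).
Proof. by apply: conj_intertwining => e e'; exact: matching_conj. Qed.

Lemma intertwining_idem e e' : match_ e e' -> inter e e'.
Proof.
move=> m; have [ee ee' _] := m; apply: conj_intertwining => f f' mf.
by rewrite !idemV //; apply: matchingM => //; exact: matchingM.
Qed.

Lemma is_join_eq0 (R : inverseMonoidType) (boolR : boolean_inverse_monoid R)
    (a b j e f : R) : idem e -> is_join a b j ->
  f * j * e = 0 <-> f * a * e = 0 /\ f * b * e = 0.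
Proof.
move=> ee J; split=> [E|[fa fb]].
  have le0 c : natural_le c j -> f * c * e = 0.
    by case=> i ii ->; rewrite -!mulgA (idemC ii ee) !mulgA E mul0g.
  by case: J => /le0 ? /le0.
have [J1 _] := boolR.1.2 _ _ _ f J; have [_ J2] := boolR.1.2 _ _ _ e J1.
by rewrite fa fb in J2; exact: is_join0 J2.
Qed.

Lemma intertwining_idem_image s t : inter s t -> idem s -> idem t.
Proof.
move=> st ss; have [e' m] := matching_total tarskiS tarskiT phiK psiK ss.
by have [_ ee' _] := m; rewrite (intertwining_fun st (intertwining_idem m)).
Qed.

(** Idempotency of [s1 * s2^-1] and [s1^-1 * s2] passes to the partners, which are therefore
    compatible; zero tests then pass to the join. *)
Lemma intertwining_join s1 s2 s t1 t2 : is_join s1 s2 s ->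
  inter s1 t1 -> inter s2 t2 -> exists t, inter s t.
Proof.
move=> J st1 st2; have [t Jt] : exists t, is_join t1 t2 t.
  have [[e ee s1E] [f ff s2E] _] := J.
  apply: boolT.1.1; split.
    apply: intertwining_idem_image (intertwiningM st1 (intertwiningV st2)) _.
    rewrite s1E s2E invgM (idemV ff) !mulgA -(mulgA s e f).
    by apply: idem_conj; exact: idemM.
  apply: intertwining_idem_image (intertwiningM (intertwiningV st1) st2) _.
  rewrite s1E s2E invgM (idemV ee) !mulgA -(mulgA e).
  by apply: idemM => //; apply: idemM => //; exact: idem_mulVg.
exists t => e e' f f' me mf; have [ee ee' _] := me.
by rewrite (is_join_eq0 boolS f ee J) (is_join_eq0 boolT f' ee' Jt) (st1 _ _ _ _ me mf)
  (st2 _ _ _ _ me mf).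
Qed.

(** Near [x], [s] agrees with a swap [g], whose partner is [phi g]. *)
Lemma intertwining_moved s (x : stone_point S) : x (s^-1 * s) ->
  act boolS s x <> x -> exists u, x u /\ exists t, inter (s * u) t.
Proof.
move=> xs sx.
have [g [u [xu gu _ _]]] :=
  swap_at xs sx (idem1 S) (point1 x) (point1 _).
have [u' m] := matching_total tarskiS tarskiT phiK psiK (point_idem xu).
exists u; split=> //; exists ((phi g : T) * u'); rewrite -gu.
exact: intertwiningM (intertwining_unit g) (intertwining_idem m).
Qed.

(** The idempotents to which the restriction of [s] has a partner form an ideal, and no point avoids
    it. *)
Lemma intertwining_total s : exists t, inter s t.
Proof.
pose J := [set e : S | idem e /\ exists t, inter (s * e) t].
have [[_ [t]]|J1] := pselect (J 1); first by rewrite mulg1; exists t.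
have inter0 : inter 0 0.
  exact: intertwining_idem (matching0 tarskiS tarskiT phiK).
have [|x xJ] := @prime_ideal _ boolS J _ J1.
  split=> [|f []//|f g [ff [t st]] gg|g f gg ff [_ [t1 st1]] [_ [t2 st2]]].
  - by split; [exact: idem0|exists 0; rewrite mulg0].
  - split; first exact: idemM.
    have [g' m] := matching_total tarskiS tarskiT phiK psiK gg.
    by exists (t * g'); rewrite mulgA; exact: intertwiningM (intertwining_idem m).
  - split=> //; rewrite !mulgA in st1 st2.
    exact: intertwining_join (is_join_neg boolS (s * g) ff) st1 st2.
have inter_J u t : x u -> ~ inter (s * u) t.
  by move=> xu st; apply: (xJ u) => //; split; [exact: point_idem xu|exists t].
have ss := idem_mulVg s.
have xs : x (s^-1 * s).
  apply: contrapT => /(point_negP boolS x ss)/inter_J; apply.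
  suff -> : s * neg (s^-1 * s) = 0 by exact: inter0.
  by rewrite -{1}(mulgVKg s) -!mulgA (mulgA s^-1) mulg_neg // mulg0.
have [sx|sx] := pselect (act boolS s x = x); last first.
  by have [u [xu [t st]]] := intertwining_moved xs sx; case: (inter_J u t).
(* Here [s] fixes [x], so take a unit [g] moving [x] to [y]: with [h] the inverse of [g], [s * h]
   moves [y] to [x], and multiplying by [g] afterwards undoes [h]. *)
have [g _ gx] := moved_within tarskiS (point1 x).
pose y := unit_act tarskiS g x; have xE : unit_act tarskiS g^-1 y = x.
  by rewrite /y -unit_actM mulVg unit_act1.
pose h : S := (g : S)^-1; have hy : act boolS h y = x := xE.
have yh : y (h^-1 * h) := point_unit g^-1 y.
have syx : act boolS (s * h) y = x by rewrite actM ?hy.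
have yc : y ((s * h)^-1 * (s * h)).
  rewrite invgM -!mulgA (mulgA s^-1) mulgA.
  by apply/(unit_actE tarskiS g^-1 y ss); rewrite xE.
have [|v [yv [t ct]]] := intertwining_moved yc; first by rewrite syx; exact/nesym.
have vv := point_idem yv.
case: (inter_J ((g : S)^-1 * v * (g : S)) (t * (phi g : T))).
  exact/(unit_actE tarskiS g x vv).
have := intertwiningM ct (intertwining_unit g).
by rewrite !mulgA.
Qed.
End Intertwining.

Theorem corollary1p3 (S T : inverseMonoidType)
    (S_countable : countably_infinite S)
    (S_congruence_free : congruence_free S)
    (S_boolean : boolean_inverse_meet_monoid S)
    (T_countable : countably_infinite T)
    (T_congruence_free : congruence_free T)
    (T_boolean : boolean_inverse_meet_monoid T) :
  isomorphic S T <-> isomorphic (units S : groupType) (units T : groupType).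
Proof.
have tarskiS : simple_tarski S by [].
have tarskiT : simple_tarski T by [].
split=> [[F /inverse_morphism[F' [FK F'K]]]|[phi /inverse_morphism[psi [phiK psiK]]]].
  have unit_image (R Q : inverseMonoidType) (h : UMagmaMorphism.type R Q) (g : units R) :
      invertible (h (g : R)).
    apply/invertibleP; exists (h ((g : R)^-1)).
    by rewrite -!gmulfM unit_val_mulgV unit_val_mulVg gmulf1.
  pose phi (g : units S) := Unit (unit_image _ _ F g).
  pose psi (g : units T) := Unit (unit_image _ _ F' g).
  have phi1 : phi 1 = 1 by apply: val_inj; exact: (@gmulf1 _ _ F).
  have phiM : {morph phi : x y / x * y}.
    by move=> x y; apply: val_inj; exact: (@gmulfM _ _ F).
  pose m := isUMagmaMorphism.Build (units S) (units T) phi (conj phi1 phiM).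
  pose Phi : UMagmaMorphism.type (units S) (units T) := HB.pack phi m.
  exists Phi; exists psi => g; apply: val_inj; [exact: FK|exact: F'K].
have total := intertwining_total tarskiS tarskiT phiK psiK.
have total' := intertwining_total tarskiT tarskiS psiK phiK.
(* Uniqueness of partners makes these choices multiplicative and mutually inverse. *)
pose F s := projT1 (cid (total s)); pose F' t := projT1 (cid (total' t)).
have FP s : intertwining tarskiS tarskiT phi s (F s) by rewrite /F; case: cid.
have F'P t : intertwining tarskiT tarskiS psi t (F' t) by rewrite /F'; case: cid.
have F1 : F 1 = 1.
  have phi1 : phi 1 = 1 by exact: gmulf1.
  have I1 : intertwining tarskiS tarskiT phi 1 (phi 1 : T).
    exact: (intertwining_unit phiK psiK 1).
  by rewrite phi1 in I1; exact: (intertwining_fun phiK psiK (FP 1) I1).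
have FM : {morph F : x y / x * y}.
  move=> x y; apply: (intertwining_fun phiK psiK (FP (x * y))).
  exact: (intertwiningM phiK psiK (FP x) (FP y)).
pose m := isUMagmaMorphism.Build S T F (conj F1 FM).
pose Phi : UMagmaMorphism.type S T := HB.pack F m.
exists Phi; exists F' => [s|t].
  exact: (intertwining_fun psiK phiK (F'P _) (intertwining_sym phiK psiK (FP s))).
exact: (intertwining_fun phiK psiK (FP _) (intertwining_sym psiK phiK (F'P t))).
Qed.
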